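(* Let $R$ be a commutative ring with unity. Consider the two zero-divisor graphs $G':=\Gamma({}_R\mathrm{mod}, \otimes_R)$ and $H':= \Gamma({}_R\mathrm{NAK}, \otimes_R)$. (1) $\chi(G') = \chi(H') = \operatorname{clique} G' = \operatorname{clique} H' = |\Omega(R)|$. (2) If $R$ is local (i.e. has only one maximal ideal), then $G' = H' = \emptyset$. (3) If $R$ has exactly two maximal ideals, then $\operatorname{diam} G' = \operatorname{diam} H' = 2$ and $\operatorname{girth} G' = \operatorname{girth} H' = 4$. (4) If $|\Omega(R)| \geq 3$, then $\operatorname{diam} H' = \operatorname{girth} H' = \operatorname{girth} G' = 3$. (5) If $|\Omega(R)| \geq 3$ and $\operatorname{Jac} R$ is prime, then $\operatorname{diam} G' = 2$. (6) If $|\Omega(R)| \geq 3$ and $\operatorname{Jac} R$ is not prime, then $\operatorname{diam} G' = 3$.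
   Context: $\Omega(R)$ is the set of maximal ideals of $R$, and $\operatorname{Jac} R$ is the intersection of all maximal ideals of $R$. An $R$-module $M$ is locally Nakayama if for all $\mathfrak{p}\in\operatorname{Spec} R$ (the set of prime ideals of $R$), $M_{\mathfrak{p}}\neq 0$ implies $M_{\mathfrak{p}}\neq \mathfrak{p}M_{\mathfrak{p}}$. ${}_R\mathrm{mod}$ denotes the collection of isomorphism classes of finitely generated $R$-modules, and ${}_R\mathrm{NAK}$ the class of isomorphism classes of locally Nakayama $R$-modules. Both are closed under $\otimes_R$ and are regarded as commutative semigroups under $\otimes_R$, with absorbing element the (class of the) zero module. The zero-divisor graph $\Gamma(S,\otimes_R)$ of such a semigroup $S$ has as vertices the nonzero $M\in S$ with $M\otimes_R N=0$ for some nonzero $N\in S$; two distinct (i.e. non-isomorphic) vertices $M,N$ are adjacent precisely when $M\otimes_R N=0$. For a graph $G$: $\operatorname{diam} G$ is the supremum of the distances between pairs of vertices; $\operatorname{girth} G$ is the length of a shortest cycle, or $\infty$ if there are no cycles; $\operatorname{clique} G$ is the supremum of the cardinalities of sets of vertices on which the induced subgraph is complete; $\chi(G)$ is the infimum of the cardinalities of sets $A$ for which there is a map from the vertices of $G$ to $A$ taking different values on adjacent vertices.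
   Formalization: Part (1) is stated only for rings R with |Ω(R)| ≠ 1: if R is local, both graphs are empty by (2), so the chromatic and clique numbers are 0 while |Ω(R)| = 1, and (1) as printed fails. *)

(* Defs.v *)
From HB Require Import structures.
From mathcomp Require Import all_boot all_algebra ring.
From mathcomp Require Import boolp.

Set Implicit Arguments.
Unset Strict Implicit.
Unset Printing Implicit Defensive.

Import GRing.Theory.
Local Open Scope ring_scope.
Local Open Scope quotient_scope.

(* Cardinals are represented by types compared through injections.  Plain      *)
(* [T -> Prop] and [card_le] are used rather than [set T] and [#<=]: these      *)
(* notions get applied to the class of all [R]-modules, and [set (lmodType R)]  *)
(* is universe inconsistent ([set T] being itself an additive monoid).          *)

Definition is_sup (T : Type) (le : T -> T -> Prop) (P : T -> Prop) (x : T) :=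
  (forall y, P y -> le y x) /\ (forall z, (forall y, P y -> le y z) -> le x z).

Definition is_inf (T : Type) (le : T -> T -> Prop) (P : T -> Prop) (x : T) :=
  (forall y, P y -> le x y) /\ (forall z, (forall y, P y -> le z y) -> le z x).

Definition card_le (A B : Type) : Prop := exists f : A -> B, injective f.
Definition card_eq (A B : Type) : Prop := exists f : A -> B, bijective f.

(* [option nat] stands for the naturals extended with infinity ([None]). *)
Definition enat_le (x y : option nat) : Prop :=
  match x, y with
  | _, None => True
  | None, Some _ => False
  | Some m, Some n => (m <= n)%N
  end.

Record graph := Graph { vertex : Type; adj : vertex -> vertex -> Prop }.

Section GraphInvariants.
Variable G : graph.

Fixpoint walk (n : nat) (u v : vertex G) : Prop :=
  if n is n'.+1 then exists w, adj u w /\ walk n' w v else u = v.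

Definition is_dist (u v : vertex G) (d : option nat) : Prop :=
  is_inf enat_le (fun x => exists2 n, walk n u v & x = Some n) d.

Definition is_diam (d : option nat) : Prop :=
  is_sup enat_le (fun x => exists u v, is_dist u v x) d.

Definition has_cycle (n : nat) : Prop :=
  (3 <= n)%N /\ exists c : 'I_n -> vertex G,
    injective c /\ forall i, adj (c i) (c (ordS i)).

Definition is_girth (g : option nat) : Prop :=
  is_inf enat_le (fun x => exists2 n, has_cycle n & x = Some n) g.

Definition complete (K : vertex G -> Prop) : Prop :=
  forall u v, K u -> K v -> u <> v -> adj u v.

Definition is_clique_number (A : Type) : Prop :=
  is_sup card_le (fun B => exists2 K, complete K & B = {v | K v}) A.

Definition is_chromatic_number (A : Type) : Prop :=
  is_inf card_le
    (fun B => exists c : vertex G -> B, forall u v, adj u v -> c u <> c v) A.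

End GraphInvariants.

(* [mul] need not be known to preserve [S]: only its vanishing matters.          *)
Section ZeroDivisorGraph.
Variables (T : Type) (mul : T -> T -> T) (zero : T) (S : T -> Prop).

Definition zd_vertex (x : T) : Prop :=
  [/\ S x, x <> zero & exists y, [/\ S y, y <> zero & mul x y = zero]].

Definition zd_graph : graph :=
  @Graph {x | zd_vertex x}
    (fun x y => sval x <> sval y /\ mul (sval x) (sval y) = zero).

End ZeroDivisorGraph.

(* Ideals.  The ones of [ring_quotient] are proper by definition and only      *)
(* available over nontrivial rings.                                            *)
Section Ideals.
Variable R : comPzRingType.

Definition is_ideal (I : R -> Prop) : Prop :=
  [/\ I 0, forall x y, I x -> I y -> I (x + y) & forall a x, I x -> I (a * x)].

Definition is_prime_ideal (p : R -> Prop) : Prop :=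
  [/\ is_ideal p, ~ p 1 & forall a b, p (a * b) -> p a \/ p b].

Definition is_maximal_ideal (m : R -> Prop) : Prop :=
  [/\ is_ideal m, ~ m 1 & forall J, is_ideal J -> ~ J 1 ->
      (forall x, m x -> J x) -> forall x, J x -> m x].

Record Spec := SpecPoint { spec_set :> R -> Prop; specP : is_prime_ideal spec_set }.

Definition Omega := {m : R -> Prop | is_maximal_ideal m}.

Definition Jac (x : R) : Prop := forall m, is_maximal_ideal m -> m x.

End Ideals.

(* A module whose laws hold up to an equivalence relation; [lquot_mod] below is *)
(* the quotient module.                                                         *)
Record lsetoid (R : comPzRingType) := LSetoid {
  ls_sort :> choiceType;
  ls_eq : ls_sort -> ls_sort -> Prop;
  ls_zero : ls_sort;
  ls_add : ls_sort -> ls_sort -> ls_sort;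
  ls_opp : ls_sort -> ls_sort;
  ls_scale : R -> ls_sort -> ls_sort;
  ls_refl : forall x, ls_eq x x;
  ls_sym : forall x y, ls_eq x y -> ls_eq y x;
  ls_trans : forall x y z, ls_eq x y -> ls_eq y z -> ls_eq x z;
  ls_eq_add : forall x x' y y',
    ls_eq x x' -> ls_eq y y' -> ls_eq (ls_add x y) (ls_add x' y');
  ls_eq_opp : forall x x', ls_eq x x' -> ls_eq (ls_opp x) (ls_opp x');
  ls_eq_scale : forall a x x', ls_eq x x' -> ls_eq (ls_scale a x) (ls_scale a x');
  ls_addA : forall x y z,
    ls_eq (ls_add x (ls_add y z)) (ls_add (ls_add x y) z);
  ls_addC : forall x y, ls_eq (ls_add x y) (ls_add y x);
  ls_add0 : forall x, ls_eq (ls_add ls_zero x) x;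
  ls_addN : forall x, ls_eq (ls_add (ls_opp x) x) ls_zero;
  ls_scaleA : forall a b x,
    ls_eq (ls_scale a (ls_scale b x)) (ls_scale (a * b) x);
  ls_scale1 : forall x, ls_eq (ls_scale 1 x) x;
  ls_scaleDr : forall a x y,
    ls_eq (ls_scale a (ls_add x y)) (ls_add (ls_scale a x) (ls_scale a y));
  ls_scaleDl : forall x a b,
    ls_eq (ls_scale (a + b) x) (ls_add (ls_scale a x) (ls_scale b x)) }.

Section QuotientModule.
Variables (R : comPzRingType) (P : lsetoid R).

Definition ls_rel (x y : P) : bool := `[< ls_eq x y >].

Lemma ls_rel_equiv : equiv_class_of ls_rel.
Proof.
split=> [x|x y|y x z].
- by apply/asboolP; apply: ls_refl.
- by apply/asboolP/asboolP; apply: ls_sym.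
- by move=> /asboolP xy /asboolP yz; apply/asboolP; apply: ls_trans xy yz.
Qed.

Canonical ls_equiv := EquivRelPack ls_rel_equiv.
Canonical ls_encModRel := defaultEncModRel ls_rel.

Definition lquot := {eq_quot ls_rel}.
HB.instance Definition _ : EqQuotient P ls_rel lquot := EqQuotient.on lquot.
HB.instance Definition _ := Choice.on lquot.

Definition lpi (x : P) : lquot := \pi_lquot x.

Lemma lpiP (x y : P) : lpi x = lpi y <-> ls_eq x y.
Proof.
split=> [/eqP|xy]; first by rewrite /lpi piE => /asboolP.
by apply/eqP; rewrite /lpi piE; apply/asboolP.
Qed.

Lemma lpiK (x : lquot) : lpi (repr x) = x.
Proof. exact: reprK. Qed.

Lemma lpi_surj (x : lquot) : exists y, x = lpi y.
Proof. by exists (repr x); rewrite lpiK. Qed.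

Lemma repr_lpi (x : P) : ls_eq (repr (lpi x)) x.
Proof. by apply/lpiP; rewrite lpiK. Qed.

Definition lquot_add (x y : lquot) := lpi (ls_add (repr x) (repr y)).
Definition lquot_opp (x : lquot) := lpi (ls_opp (repr x)).
Definition lquot_scale (a : R) (x : lquot) := lpi (ls_scale a (repr x)).

Lemma lquot_addE x y : lquot_add (lpi x) (lpi y) = lpi (ls_add x y).
Proof. by apply/lpiP; apply: ls_eq_add; apply: repr_lpi. Qed.

Lemma lquot_oppE x : lquot_opp (lpi x) = lpi (ls_opp x).
Proof. by apply/lpiP; apply: ls_eq_opp; apply: repr_lpi. Qed.

Lemma lquot_scaleE a x : lquot_scale a (lpi x) = lpi (ls_scale a x).
Proof. by apply/lpiP; apply: ls_eq_scale; apply: repr_lpi. Qed.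

Let E := (lquot_addE, lquot_oppE, lquot_scaleE).

Lemma lquot_addA : associative lquot_add.
Proof.
move=> x y z; rewrite -[x]lpiK -[y]lpiK -[z]lpiK !E.
exact/lpiP/ls_addA.
Qed.

Lemma lquot_addC : commutative lquot_add.
Proof. by move=> x y; rewrite -[x]lpiK -[y]lpiK !E; apply/lpiP/ls_addC. Qed.

Lemma lquot_add0 : left_id (lpi (ls_zero P)) lquot_add.
Proof. by move=> x; rewrite -[x]lpiK !E; apply/lpiP/ls_add0. Qed.

Lemma lquot_addN : left_inverse (lpi (ls_zero P)) lquot_opp lquot_add.
Proof. by move=> x; rewrite -[x]lpiK !E; apply/lpiP/ls_addN. Qed.

HB.instance Definition _ :=
  GRing.isZmodule.Build lquot lquot_addA lquot_addC lquot_add0 lquot_addN.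

Lemma lquot_scaleA a b x : lquot_scale a (lquot_scale b x) = lquot_scale (a * b) x.
Proof. by rewrite -[x]lpiK !E; apply/lpiP/ls_scaleA. Qed.

Lemma lquot_scale1 : left_id 1 lquot_scale.
Proof. by move=> x; rewrite -[x]lpiK !E; apply/lpiP/ls_scale1. Qed.

Lemma lquot_scaleDr : right_distributive lquot_scale +%R.
Proof.
by move=> a x y; rewrite -[x]lpiK -[y]lpiK /GRing.add /= !E; apply/lpiP/ls_scaleDr.
Qed.

Lemma lquot_scaleDl x : {morph lquot_scale^~ x : a b / a + b}.
Proof.
by move=> a b; rewrite -[x]lpiK [RHS]/GRing.add /= !E; apply/lpiP/ls_scaleDl.
Qed.

HB.instance Definition _ := GRing.Zmodule_isLmodule.Build R lquot
  lquot_scaleA lquot_scale1 lquot_scaleDr lquot_scaleDl.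

Definition lquot_mod : lmodType R := lquot.

Lemma lpi0 : lpi (ls_zero P) = 0. Proof. by []. Qed.
Lemma lpiD x y : lpi (ls_add x y) = lpi x + lpi y.
Proof. by rewrite -lquot_addE. Qed.
Lemma lpiN x : lpi (ls_opp x) = - lpi x.
Proof. by rewrite -lquot_oppE. Qed.
Lemma lpiZ a x : lpi (ls_scale a x) = a *: lpi x.
Proof. by rewrite -lquot_scaleE. Qed.

End QuotientModule.

(* Tensor product: the commutative monoid on the generators (m, n), whose      *)
(* elements are represented by finite sequences, modulo the bilinear relations.*)
(* It is a group since [(- m, n)] is inverse to [(m, n)].                      *)
Section Tensor.
Variables (R : comPzRingType) (M N : lmodType R).

Inductive tens_eq : seq (M * N) -> seq (M * N) -> Prop :=
| tens_refl u : tens_eq u u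
| tens_sym u v : tens_eq u v -> tens_eq v u
| tens_trans u v w : tens_eq u v -> tens_eq v w -> tens_eq u w
| tens_cat u u' v v' :
    tens_eq u u' -> tens_eq v v' -> tens_eq (u ++ v) (u' ++ v')
| tens_catC u v : tens_eq (u ++ v) (v ++ u)
| tens_0l n : tens_eq [:: (0, n)] [::]
| tens_Dl m m' n : tens_eq [:: (m + m', n)] [:: (m, n); (m', n)]
| tens_Dr m n n' : tens_eq [:: (m, n + n')] [:: (m, n); (m, n')]
| tens_Z a m n : tens_eq [:: (a *: m, n)] [:: (m, a *: n)].

Definition tens_opp (u : seq (M * N)) := [seq (- x.1, x.2) | x <- u].
Definition tens_scale (a : R) (u : seq (M * N)) := [seq (a *: x.1, x.2) | x <- u].

Lemma tens_eq_scale a u v : tens_eq u v -> tens_eq (tens_scale a u) (tens_scale a v).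
Proof.
elim=> {u v} /=.
- by move=> u; apply: tens_refl.
- by move=> u v _; apply: tens_sym.
- by move=> u v w _ IH1 _; apply: tens_trans IH1.
- by move=> u u' v v' _ IH1 _ IH2; rewrite /tens_scale !map_cat; apply: tens_cat.
- by move=> u v; rewrite /tens_scale !map_cat; apply: tens_catC.
- by move=> n; rewrite scaler0; apply: tens_0l.
- by move=> m m' n; rewrite scalerDr; apply: tens_Dl.
- by move=> m n n'; apply: tens_Dr.
- by move=> b m n; rewrite scalerA mulrC -scalerA; apply: tens_Z.
Qed.

Lemma tens_oppE u : tens_opp u = tens_scale (-1) u.
Proof. by apply: eq_map => x; rewrite scaleN1r. Qed.

Lemma tens_addN u : tens_eq (tens_opp u ++ u) [::].
Proof.
elim: u => [|[m n] u IH] /=; first exact: tens_refl.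
apply: (@tens_trans _ ([:: (- m, n)] ++ ([:: (m, n)] ++ (tens_opp u ++ u)))).
  rewrite -(cat1s _ (_ ++ _ :: u)); apply: tens_cat; first exact: tens_refl.
  rewrite -[(m, n) :: u]cat1s !catA; apply: tens_cat; last exact: tens_refl.
  exact: tens_catC.
rewrite catA -[[::]]cats0; apply: tens_cat IH => /=.
apply: tens_trans (tens_sym (tens_Dl _ _ _)) _.
by rewrite addNr; apply: tens_0l.
Qed.

Lemma tens_scaleDl u a b :
  tens_eq (tens_scale (a + b) u) (tens_scale a u ++ tens_scale b u).
Proof.
elim: u => [|[m n] u IH] /=; first exact: tens_refl.
apply: (@tens_trans _ ([:: (a *: m, n); (b *: m, n)] ++
                       (tens_scale a u ++ tens_scale b u))).
  rewrite -cat1s; apply: tens_cat IH.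
  by rewrite scalerDl; apply: tens_Dl.
rewrite /= -cat1s -[X in tens_eq _ X]cat1s; apply: tens_cat; first exact: tens_refl.
rewrite -cat1s -[(b *: m, n) :: tens_scale b u]cat1s !catA.
by apply: tens_cat; [apply: tens_catC | apply: tens_refl].
Qed.

Definition tens_lsetoid : lsetoid R.
Proof.
apply: (@LSetoid R (seq (M * N)) tens_eq [::] cat tens_opp tens_scale).
- exact: tens_refl.
- exact: tens_sym.
- exact: tens_trans.
- exact: tens_cat.
- by move=> u v uv; rewrite !tens_oppE; apply: tens_eq_scale.
- exact: tens_eq_scale.
- by move=> u v w; rewrite catA; apply: tens_refl.
- exact: tens_catC.
- by move=> u; apply: tens_refl.
- exact: tens_addN.
- move=> a b u; rewrite /tens_scale -map_comp.
  rewrite (eq_map (g := fun x => ((a * b) *: x.1, x.2))); first exact: tens_refl.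
  by move=> x /=; rewrite scalerA.
- move=> u; rewrite /tens_scale (eq_map (g := id)) ?map_id; first exact: tens_refl.
  by case=> m n; rewrite scale1r.
- by move=> a u v; rewrite /tens_scale map_cat; apply: tens_refl.
- exact: tens_scaleDl.
Defined.

Definition tensor : lmodType R := lquot_mod tens_lsetoid.

Definition tens (m : M) (n : N) : tensor := @lpi R tens_lsetoid [:: (m, n)].

Lemma tensDl m m' n : tens (m + m') n = tens m n + tens m' n.
Proof. by rewrite /tens -lpiD; apply/lpiP/tens_Dl. Qed.

Lemma tensDr m n n' : tens m (n + n') = tens m n + tens m n'.
Proof. by rewrite /tens -lpiD; apply/lpiP/tens_Dr. Qed.

Lemma tensZl a m n : tens (a *: m) n = a *: tens m n.
Proof. by rewrite /tens -lpiZ. Qed.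

Lemma tensZr a m n : tens m (a *: n) = a *: tens m n.
Proof. by rewrite -tensZl; apply/lpiP/tens_sym/tens_Z. Qed.

Lemma lpi_tens (u : seq (M * N)) :
  @lpi R tens_lsetoid u = \sum_(x <- u) tens x.1 x.2.
Proof.
elim: u => [|[m n] u IH]; first by rewrite big_nil.
by rewrite big_cons -IH /tens -lpiD.
Qed.

Lemma tens_ext (P : lmodType R) (f g : {linear tensor -> P}) :
  (forall m n, f (tens m n) = g (tens m n)) -> f =1 g.
Proof.
move=> fg x; have [u ->] := lpi_surj x.
by rewrite lpi_tens !linear_sum; apply: eq_bigr => y _; apply: fg.
Qed.

Section Universal.
Variables (P : lmodType R) (b : M -> N -> P).
Hypothesis bDl : forall m m' n, b (m + m') n = b m n + b m' n.
Hypothesis bDr : forall m n n', b m (n + n') = b m n + b m n'.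
Hypothesis bZl : forall a m n, b (a *: m) n = a *: b m n.
Hypothesis bZr : forall a m n, b m (a *: n) = a *: b m n.

Let word_sum (u : seq (M * N)) : P := \sum_(x <- u) b x.1 x.2.

Let word_sum_eq u v : tens_eq u v -> word_sum u = word_sum v.
Proof.
rewrite /word_sum; elim=> {u v} //=.
- by move=> u v w _ -> _ ->.
- by move=> u u' v v' _ IH1 _ IH2; rewrite !big_cat /= IH1 IH2.
- by move=> u v; rewrite !big_cat /= addrC.
- by move=> n; rewrite big_seq1 big_nil /= -(scale0r 0) bZl scale0r.
- by move=> m m' n; rewrite big_seq1 big_cons big_seq1 bDl.
- by move=> m n n'; rewrite big_seq1 big_cons big_seq1 bDr.
- by move=> a m n; rewrite !big_seq1 /= bZl bZr.
Qed.

Let lift (x : tensor) : P := word_sum (repr x).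

Let liftE (u : tens_lsetoid) : lift (lpi u) = word_sum u.
Proof. exact/word_sum_eq/(@repr_lpi R tens_lsetoid). Qed.

Let lift_linear : linear lift.
Proof.
move=> a x y; have [u ->] := lpi_surj x; have [v ->] := lpi_surj y.
rewrite -lpiZ -lpiD !liftE /word_sum big_cat big_map scaler_sumr.
by congr (_ + _); apply: eq_bigr => z _; rewrite bZl.
Qed.

Lemma tensor_universal : exists f : {linear tensor -> P},
  forall m n, f (tens m n) = b m n.
Proof.
pose F := GRing.isLinear.Build R tensor P _ lift lift_linear.
pose f : {linear tensor -> P} := HB.pack lift F.
by exists f => m n; rewrite /= /tens liftE /word_sum big_seq1.
Qed.

End Universal.

End Tensor.

(* M_p is only given its [R]-module structure: this does not affect whether it *)
(* is zero, and p M_p is the same whether generated over [R] or over R_p.      *)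
Section Localization.
Variables (R : comPzRingType) (M : lmodType R) (p : Spec R).

Definition denom := {s : R | `[< ~ p s >]}.

Lemma denomP (s : denom) : ~ p (sval s).
Proof. exact/asboolP/(valP s). Qed.

Lemma denom1_subproof : `[< ~ p 1 >].
Proof. by apply/asboolP; case: (specP p). Qed.
Definition denom1 : denom := Sub 1 denom1_subproof.

Lemma denomM_subproof (s t : denom) : `[< ~ p (sval s * sval t) >].
Proof.
apply/asboolP; have [_ _ pM] := specP p.
by move=> /pM[]; apply: denomP.
Qed.
Definition denomM (s t : denom) : denom := Sub (sval s * sval t) (denomM_subproof s t).

(* The pair [(m, s)] stands for the fraction m / s. *)
Definition loc_eq (x y : M * denom) : Prop :=
  exists u : denom,
    sval u *: (sval y.2 *: x.1) = sval u *: (sval x.2 *: y.1).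

Definition loc_add (x y : M * denom) : M * denom :=
  (sval y.2 *: x.1 + sval x.2 *: y.1, denomM x.2 y.2).
Definition loc_opp (x : M * denom) : M * denom := (- x.1, x.2).
Definition loc_scale (a : R) (x : M * denom) : M * denom := (a *: x.1, x.2).


Lemma loc_eq_trans x y z : loc_eq x y -> loc_eq y z -> loc_eq x z.
Proof.
case: x y z => [m s] [n t] [k r] [u /= Eu] [v /= Ev].
exists (denomM (denomM u v) t) => /=.
move: Eu Ev; rewrite !scalerA => Eu Ev.
have -> : sval u * sval v * sval t * sval r = sval v * sval r * (sval u * sval t) by ring.
rewrite -scalerA Eu scalerA.
have -> : sval v * sval r * (sval u * sval s) = sval u * sval s * (sval v * sval r) by ring.
by rewrite -scalerA Ev scalerA; congr (_ *: _); ring.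
Qed.

Lemma loc_eq_add x x' y y' :
  loc_eq x x' -> loc_eq y y' -> loc_eq (loc_add x y) (loc_add x' y').
Proof.
case: x x' y y' => [m s] [m' s'] [n t] [n' t'] [u /= Eu] [v /= Ev].
exists (denomM u v) => /=; move: Eu Ev; rewrite !scalerDr !scalerA => Eu Ev.
congr (_ + _).
  have -> : sval u * sval v * (sval s' * sval t') * sval t =
    sval v * sval t' * sval t * (sval u * sval s') by ring.
  by rewrite -scalerA Eu scalerA; congr (_ *: _); ring.
have -> : sval u * sval v * (sval s' * sval t') * sval s =
  sval u * sval s' * sval s * (sval v * sval t') by ring.
by rewrite -scalerA Ev scalerA; congr (_ *: _); ring.
Qed.

Lemma loc_eq_scale a x x' : loc_eq x x' -> loc_eq (loc_scale a x) (loc_scale a x').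
Proof.
case: x x' => [m s] [m' s'] [u /= Eu]; exists u => /=.
move/(congr1 ( *:%R a)): Eu; rewrite !scalerA => E.
by rewrite [_ * a]mulrC mulrA E; congr (_ *: _); ring.
Qed.

Lemma loc_eq_parts m m' (s s' : denom) :
  m = m' -> sval s = sval s' -> loc_eq (m, s) (m', s').
Proof. by move=> -> E; exists s; rewrite /= E. Qed.

Definition loc_lsetoid : lsetoid R.
Proof.
apply: (@LSetoid R (M * denom)%type loc_eq (0, denom1) loc_add loc_opp loc_scale).
- by move=> x; exists denom1.
- by move=> x y [u]; exists u.
- exact: loc_eq_trans.
- exact: loc_eq_add.
- by move=> [m s] [m' s'] [u /= Eu]; exists u; rewrite /= !scalerN Eu.
- exact: loc_eq_scale.
- move=> [m s] [n t] [k r]; apply: loc_eq_parts => /=; last by rewrite mulrA.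
  by rewrite !scalerDr !scalerA addrA; do 2![congr (_ + _)];
    congr (_ *: _); ring.
- move=> [m s] [n t]; apply: loc_eq_parts => /=; last exact: mulrC.
  exact: addrC.
- by move=> [m s]; apply: loc_eq_parts => /=; rewrite ?scaler0 ?add0r ?scale1r ?mul1r.
- by move=> [m s]; exists s; rewrite /= scalerN addNr !scaler0.
- by move=> a b [m s]; apply: loc_eq_parts => //=; rewrite scalerA.
- by move=> [m s]; apply: loc_eq_parts => //=; rewrite scale1r.
- move=> a [m s] [n t]; apply: loc_eq_parts => //=.
  by rewrite scalerDr !scalerA; congr (_ *: _ + _ *: _); ring.
- move=> [m s] a b; exists s => /=; congr (_ *: _).
  by rewrite !scalerA -!scalerDl scalerA; congr (_ *: _); ring.
Defined.

Definition localization : lmodType R := lquot_mod loc_lsetoid.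

Definition frac (m : M) (s : denom) : localization := @lpi R loc_lsetoid (m, s).

End Localization.

(* [I N], the submodule of finite sums of products of elements of [I] and [N]. *)
Definition ideal_mul (R : comPzRingType) (I : R -> Prop) (N : lmodType R) (x : N) :=
  exists n (a : 'I_n -> R) (y : 'I_n -> N),
    (forall i, I (a i)) /\ x = \sum_i a i *: y i.

Definition finitely_generated (R : comPzRingType) (M : lmodType R) : Prop :=
  exists n (e : 'I_n -> M), forall x : M, exists a : 'I_n -> R, x = \sum_i a i *: e i.

Definition locally_nakayama (R : comPzRingType) (M : lmodType R) : Prop :=
  forall p : Spec R, (exists x : localization M p, x <> 0) ->
    ~ (forall x : localization M p, ideal_mul p x).

Definition lmod_iso (R : comPzRingType) (M N : lmodType R) : Prop :=
  exists f : {linear M -> N}, bijective f.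

Record isoclass (R : comPzRingType) := IsoClass {
  in_class : lmodType R -> Prop;
  isoclassP : exists M, in_class = lmod_iso M }.

Section IsoClasses.
Variable R : comPzRingType.
Implicit Types (M N P : lmodType R) (C D : isoclass R).

Lemma lmod_isoP M N : lmod_iso M N <->
  exists (f : {linear M -> N}) (g : {linear N -> M}), cancel f g /\ cancel g f.
Proof.
split=> [[f [g fK gK]]|[f [g [fK gK]]]]; last by exists f; exists g.
have gL : linear g by move=> a x y; rewrite -{1}[x]gK -{1}[y]gK -linearP fK.
pose g' : {linear N -> M} := HB.pack g (GRing.isLinear.Build R N M _ g gL).
by exists f, g'.
Qed.

Lemma lmod_iso_refl M : lmod_iso M M.
Proof. by exists idfun; exists idfun. Qed.

Lemma lmod_iso_sym M N : lmod_iso M N -> lmod_iso N M.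
Proof. by case/lmod_isoP=> f [g [fK gK]]; apply/lmod_isoP; exists g, f. Qed.

Lemma lmod_iso_trans M N P : lmod_iso M N -> lmod_iso N P -> lmod_iso M P.
Proof. by case=> f fb [g gb]; exists (g \o f); apply: bij_comp. Qed.

Definition iso_cls M : isoclass R := IsoClass (ex_intro _ M erefl).

Lemma isoclass_ext C D : in_class C = in_class D -> C = D.
Proof.
case: C D => [c p] [d q] /= E; subst d.
by congr IsoClass; apply: Prop_irrelevance.
Qed.

Definition iso_repr C : lmodType R := projT1 (cid (isoclassP C)).

Lemma iso_reprK C : iso_cls (iso_repr C) = C.
Proof. by apply: isoclass_ext; rewrite /iso_repr; case: cid. Qed.

Lemma iso_clsP M N : iso_cls M = iso_cls N <-> lmod_iso M N.
Proof.
split=> [/(congr1 (@in_class R)) /= ->|MN]; first exact: lmod_iso_refl.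
apply: isoclass_ext => /=; apply/funext => P; apply/propext.
split; last exact: lmod_iso_trans.
by apply: lmod_iso_trans; apply: lmod_iso_sym.
Qed.

Lemma iso_repr_cls M : lmod_iso (iso_repr (iso_cls M)) M.
Proof. by apply/iso_clsP; rewrite iso_reprK. Qed.

Lemma tensor_map M M' N N' (f : {linear M -> M'}) (g : {linear N -> N'}) :
  exists h : {linear tensor M N -> tensor M' N'},
    forall m n, h (tens m n) = tens (f m) (g n).
Proof.
apply: (@tensor_universal R M N (tensor M' N') (fun m n => tens (f m) (g n))).
- by move=> m m' n; rewrite linearD tensDl.
- by move=> m n n'; rewrite linearD tensDr.
- by move=> a m n; rewrite linearZ tensZl.
- by move=> a m n; rewrite linearZ tensZr.
Qed.

Lemma tensor_iso M M' N N' :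
  lmod_iso M M' -> lmod_iso N N' -> lmod_iso (tensor M N) (tensor M' N').
Proof.
move=> /lmod_isoP[f [f' [fK f'K]]] /lmod_isoP[g [g' [gK g'K]]].
have [h hE] := tensor_map f g; have [h' h'E] := tensor_map f' g'.
apply/lmod_isoP; exists h, h'; split.
  by apply: (@tens_ext R M N _ (h' \o h) idfun) => m n; rewrite /= hE h'E fK gK.
by apply: (@tens_ext R M' N' _ (h \o h') idfun) => m n; rewrite /= h'E hE f'K g'K.
Qed.

Definition zero_class : isoclass R := iso_cls 'rV[R]_0.

Definition tensor_class C D : isoclass R := iso_cls (tensor (iso_repr C) (iso_repr D)).

Lemma tensor_classE M N :
  tensor_class (iso_cls M) (iso_cls N) = iso_cls (tensor M N).
Proof. by apply/iso_clsP; apply: tensor_iso; apply: iso_repr_cls. Qed.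

Definition fg_class C : Prop := exists2 M, C = iso_cls M & finitely_generated M.

Definition nak_class C : Prop := exists2 M, C = iso_cls M & locally_nakayama M.

End IsoClasses.

(* Main.v *)
From mathcomp Require Import all_boot all_algebra ring boolp classical_sets.
Require Import Defs.

(** The support of a module M, here restricted to maximal ideals, is the set of
    the m with M_m <> 0; it is empty only for M = 0.  The point of the locally
    Nakayama condition is that the vanishing of tensor products can be read on
    these sets: if M and N are locally Nakayama, then M (x) N = 0 if and only
    if the supports of M and N are disjoint ([tensor_eq0P]).  Indeed, if m is in
    both supports, then M <> mM and N <> mN, so that M and N have nonzero maps
    to the field R/m, and the product of these maps is a nonzero bilinear map.
    Conversely, the annihilator of a nonzero x (x) y lies in some maximal m, so
    that x/1 and y/1 are nonzero in M_m and N_m.  Finitely generated modules are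
    locally Nakayama ([fg_locally_nakayama]), so this covers both graphs.

    Consequently, in either graph the vertices are the modules of the class
    whose support is neither empty nor everything, and adjacency is disjointness
    of supports.  The residue fields R/m have the singletons as their supports.
    Everything about cliques, colourings and cycles follows at once: choosing a
    point in each support is a colouring by Omega(R) which is injective on
    cliques, while the R/m form a clique indexed by Omega(R); over two maximal
    ideals the graph is bipartite, and (R/m)^2, which has the support of R/m
    without being isomorphic to it, provides a 4-cycle.

    Two vertices missing a common m are joined through R/m, and if u misses m and
    v misses n, then u - R/m - R/n - v is a walk, so that the diameter is at most
    3.  It is 3 exactly when two vertices have supports which meet and together
    cover Omega(R) ([diam3], [diam2]).  For locally Nakayama modules, the sums of
    all residue fields but one provide such supports.  For finitely generated
    modules, the support is cut out by the annihilator; two proper supports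
    covering Omega(R) give s, t outside Jac R with st in Jac R, so that there are
    none if Jac R is prime, and otherwise R/a and R/b will do for suitable a, b
    with ab in Jac R ([overlapping_cover]). *)

Set Implicit Arguments.
Unset Strict Implicit.
Unset Printing Implicit Defensive.

Import GRing.Theory.
Local Open Scope ring_scope.

(** * Maximal ideals and maximal submodules *)

Section Ideals.
Variable R : comPzRingType.
Implicit Types I J m p : R -> Prop.

Lemma is_idealN I : is_ideal I -> forall x, I x -> I (- x).
Proof. by move=> [_ _ IM] x Ix; rewrite -mulN1r; apply: IM. Qed.

Lemma is_idealB I : is_ideal I -> forall x y, I x -> I y -> I (x - y).
Proof. by move=> Ii x y Ix Iy; have [_ ID _] := Ii; apply: ID => //; apply: is_idealN. Qed.

Lemma is_idealMr I : is_ideal I -> forall x a, I x -> I (x * a).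
Proof. by move=> [_ _ IM] x a Ix; rewrite mulrC; apply: IM. Qed.

Lemma ideal_ladd I x y : is_ideal I -> I (x - y) -> I y -> I x.
Proof. by move=> [_ ID _] Ixy Iy; rewrite -[x](subrK y); apply: ID. Qed.

Lemma ideal_eqM I : is_ideal I -> forall a b c d,
  I (a - b) -> I (c - d) -> I (a * c - b * d).
Proof.
move=> Ii a b c d Iab Icd; have [_ ID IM] := Ii.
have -> : a * c - b * d = c * (a - b) + b * (c - d) by ring.
by apply: ID; apply: IM.
Qed.

Lemma ideal_eqD I : is_ideal I -> forall a b c d,
  I (a - b) -> I (c - d) -> I (a + c - (b + d)).
Proof.
move=> Ii a b c d Iab Icd; have [_ ID IM] := Ii.
by have -> : a + c - (b + d) = (a - b) + (c - d); [ring | apply: ID].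
Qed.

(** Otherwise m + (a) would be a larger proper ideal. *)
Lemma maximal_inv m a : is_maximal_ideal m -> ~ m a -> exists b, m (1 - b * a).
Proof.
move=> [mI m1 mmax] ma; have [m0 mD mM] := mI.
pose J x := exists b, m (x - b * a).
have JI : is_ideal J.
  split; first by exists 0; rewrite mul0r subr0.
    move=> x y [b mb] [c mc]; exists (b + c).
    by have -> : x + y - (b + c) * a = (x - b * a) + (y - c * a); [ring | apply: mD].
  move=> c x [b mb]; exists (c * b).
  by have -> : c * x - c * b * a = c * (x - b * a); [ring | apply: mM].
apply: contrapT => nJ1; apply/ma/(mmax J JI nJ1).
  by move=> x mx; exists 0; rewrite mul0r subr0.
by exists 1; rewrite mul1r subrr.
Qed.

Lemma maximal_prime m : is_maximal_ideal m -> is_prime_ideal m.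
Proof.
move=> mm; have [mI m1 _] := mm; have [m0 mD mM] := mI; split=> // a b mab.
have [ma|/(maximal_inv mm)[c mc]] := pselect (m a); [by left | right].
have -> : b = c * (a * b) + b * (1 - c * a) by ring.
by apply: mD; apply: mM.
Qed.

Lemma maximal_incl m p : is_maximal_ideal m -> is_prime_ideal p ->
  (forall x, m x -> p x) -> m = p.
Proof.
move=> [_ _ mmax] [pI p1 _] mp; apply/funext => x; apply/propext.
by split; [apply: mp | apply: mmax].
Qed.

Lemma maximal_neq m n : is_maximal_ideal m -> is_maximal_ideal n -> m <> n ->
  exists2 s, m s & ~ n s.
Proof.
move=> mm nm mn; apply: contrapT => H; apply: mn.
apply: maximal_incl (maximal_prime nm) _ => // x mx.
by apply: contrapT => nx; apply: H; exists x.
Qed.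

Lemma is_prime_ideal_exp p s n : is_prime_ideal p -> ~ p s -> ~ p (s ^+ n).
Proof.
move=> [_ p1 pM] ps; elim: n => [|n IH]; first by rewrite expr0.
by rewrite exprS => /pM[].
Qed.

End Ideals.

Section Zorn.
Variables (R : comPzRingType) (M : lmodType R).
Implicit Types K L : M -> Prop.

Definition is_submodule K :=
  [/\ K 0, forall x y, K x -> K y -> K (x + y) & forall a x, K x -> K (a *: x)].

(** The common source of maximal ideals (for the regular module and x = 1) and of
    functionals modulo a maximal ideal.  The last property holds because K + Ry
    contains x as soon as y is outside of K. *)
Lemma maximal_avoiding (K0 : M -> Prop) (x : M) : is_submodule K0 -> ~ K0 x ->
  exists K, [/\ is_submodule K, forall y, K0 y -> K y, ~ K x &
    forall y, ~ K y -> exists a, K (x - a *: y)].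
Proof.
move=> K0s K0x.
pose good K := [/\ is_submodule K, forall y, K0 y -> K y & ~ K x].
(* The empty set is admitted because it is the union of the empty chain; it is
   never maximal, since it is strictly contained in K0. *)
have [F FP Ftot|A [PA Amax]] := @Zorn_bigcup M (fun K => K = set0 \/ good K).
  have [[K [FK [k Kk]]]|none] := pselect (exists K, F K /\ exists k, K k); last first.
    left; rewrite -subset0 => y [K FK Ky].
    by apply: none; exists K; split=> //; exists y.
  have goodF L z : F L -> L z -> good L.
    by move=> /FP[->//|].
  right; have [[K_0 _ _] K0K _] := goodF _ _ FK Kk; split.
  - split; first by exists K.
      move=> y z [L FL Ly] [L' FL' L'z].
      have [[_ LD _] _ _] := goodF _ _ FL Ly; have [[_ L'D _] _ _] := goodF _ _ FL' L'z.
      by case: (Ftot L L' FL FL') => sub; [exists L' | exists L] => //;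
        [apply: L'D => //; apply: sub | apply: LD => //; apply: sub].
    move=> a y [L FL Ly]; exists L => //.
    by have [[_ _ LZ] _ _] := goodF _ _ FL Ly; apply: LZ.
  - by move=> y K0y; exists K => //; apply: K0K.
  - by move=> [L FL Lx]; have [_ _] := goodF _ _ FL Lx; apply.
have {PA} [As K0A Ax] : good A.
  case: PA => // A0; have [K00 _ _] := K0s.
  case: (Amax K0); last by right; split.
  by rewrite A0; split=> // /(_ _ K00).
exists A; split=> // y Ay; have [A0 AD AZ] := As; apply: contrapT => none.
pose B z := exists a, A (z - a *: y).
have AB z : A z -> B z by exists 0; rewrite scale0r subr0.
case: (Amax B).
  by split=> // /(_ y) BA; apply/Ay/BA; exists 1; rewrite scale1r subrr.
right; split=> //; last by move=> z /K0A/AB.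
split; first exact: AB.
  move=> z t [a Aa] [b Ab]; exists (a + b).
  by rewrite scalerDl opprD addrACA; apply: AD.
move=> c z [a Aa]; exists (c * a).
by rewrite -scalerA -scalerBr; apply: AZ.
Qed.

End Zorn.

Lemma maximal_above (R : comPzRingType) (I : R -> Prop) :
  is_ideal I -> ~ I 1 -> exists2 m, is_maximal_ideal m & forall x, I x -> m x.
Proof.
move=> Ii I1; have [m [ms Im m1 mmax]] := @maximal_avoiding R R^o I 1 Ii I1.
exists m => //; split; [exact: ms | exact: m1 | move=> J Ji J1 mJ x Jx].
apply: contrapT => /mmax[a /mJ Ja].
by apply: J1; apply: (ideal_ladd Ji Ja); have [_ _ JM] := Ji; apply: JM.
Qed.

(** * Direct sums of cyclic modules *)

Section DirectSum.
Variables (R : comPzRingType) (J : choiceType) (I : J -> R -> Prop).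
Hypothesis I_ideal : forall j, is_ideal (I j).

Definition word_coord (j : J) (u : seq (J * R)) : R := \sum_(w <- u | w.1 == j) w.2.

Definition word_scale (a : R) (u : seq (J * R)) := [seq (w.1, a * w.2) | w <- u].

Lemma word_coord_cat j u v : word_coord j (u ++ v) = word_coord j u + word_coord j v.
Proof. by rewrite /word_coord big_cat. Qed.

Lemma word_coord_scale j a u : word_coord j (word_scale a u) = a * word_coord j u.
Proof. by rewrite /word_coord big_map /= -big_distrr. Qed.

Definition word_eq (u v : seq (J * R)) := forall j, I j (word_coord j u - word_coord j v).

Lemma word_eq_refl u v : word_coord ^~ u =1 word_coord ^~ v -> word_eq u v.
Proof. by move=> uv j; rewrite uv subrr; have [] := I_ideal j. Qed.

(** The direct sum of the R/(I j): a word stands for the sum of the classes of its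
    letters (j, a), a in R/(I j).  Words are used rather than functions so that
    supports are finite even if J is infinite. *)
Definition dsum_lsetoid : lsetoid R.
Proof.
apply: (@LSetoid R (seq (J * R)) word_eq [::] cat (word_scale (-1)) word_scale).
- by move=> u; apply: word_eq_refl.
- by move=> u v uv j; rewrite -opprB; apply: is_idealN.
- move=> u v w uv vw j; have [_ ID _] := I_ideal j.
  by rewrite -(subrKA (word_coord j v)); apply: ID.
- by move=> u u' v v' uu vv j; rewrite !word_coord_cat; apply: ideal_eqD.
- move=> u v uv j; rewrite !word_coord_scale -mulrBr.
  by have [_ _ IM] := I_ideal j; apply: IM.
- move=> a u v uv j; rewrite !word_coord_scale -mulrBr.
  by have [_ _ IM] := I_ideal j; apply: IM.
- by move=> u v w; apply: word_eq_refl => j; rewrite catA.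
- by move=> u v; apply: word_eq_refl => j; rewrite !word_coord_cat addrC.
- by move=> u; apply: word_eq_refl => j.
- move=> u; apply: word_eq_refl => j.
  by rewrite word_coord_cat word_coord_scale mulN1r addNr /word_coord big_nil.
- by move=> a b u; apply: word_eq_refl => j; rewrite !word_coord_scale mulrA.
- by move=> u; apply: word_eq_refl => j; rewrite word_coord_scale mul1r.
- move=> a u v; apply: word_eq_refl => j.
  by rewrite !(word_coord_cat, word_coord_scale) mulrDr.
- move=> u a b; apply: word_eq_refl => j.
  by rewrite !(word_coord_cat, word_coord_scale) mulrDl.
Defined.

Definition dsum : lmodType R := lquot_mod dsum_lsetoid.

(** A representative in R of the coordinate in R/(I j); only its class modulo
    I j is meaningful, hence the congruences below. *)
Definition dsum_coord (j : J) (x : dsum) : R := word_coord j (repr x).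

Definition dsum_in (j : J) (a : R) : dsum := @lpi R dsum_lsetoid [:: (j, a)].

Lemma dsum_coord_lpi j u :
  I j (dsum_coord j (@lpi R dsum_lsetoid u) - word_coord j u).
Proof. exact: (@repr_lpi R dsum_lsetoid u j). Qed.

Lemma dsum_coord_in j a : I j (dsum_coord j (dsum_in j a) - a).
Proof.
by have := dsum_coord_lpi j [:: (j, a)]; rewrite /word_coord big_cons big_nil eqxx addr0.
Qed.

Lemma dsum_coord_in_neq j k a : j != k -> I k (dsum_coord k (dsum_in j a)).
Proof.
move=> jk; have := dsum_coord_lpi k [:: (j, a)].
by rewrite /word_coord big_cons big_nil (negPf jk) subr0.
Qed.

Lemma dsum_coord0 j : I j (dsum_coord j 0).
Proof. by have := dsum_coord_lpi j [::]; rewrite /word_coord big_nil subr0. Qed.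

Lemma dsum_coordD j x y :
  I j (dsum_coord j (x + y) - (dsum_coord j x + dsum_coord j y)).
Proof.
by rewrite -word_coord_cat -{1}[x]lpiK -{1}[y]lpiK -lpiD; apply: dsum_coord_lpi.
Qed.

Lemma dsum_coordZ j a x : I j (dsum_coord j (a *: x) - a * dsum_coord j x).
Proof. by rewrite -word_coord_scale -{1}[x]lpiK -lpiZ; apply: dsum_coord_lpi. Qed.

Lemma dsum_inD j a b : dsum_in j (a + b) = dsum_in j a + dsum_in j b.
Proof.
rewrite /dsum_in -lpiD; apply/lpiP/word_eq_refl => k.
by rewrite /word_coord !big_cons big_nil /=; case: eqP; rewrite ?addr0.
Qed.

Lemma dsum_inZ j a b : dsum_in j (a * b) = a *: dsum_in j b.
Proof. by rewrite /dsum_in -lpiZ. Qed.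

Lemma dsum_in_eq0 j a : dsum_in j a = 0 <-> I j a.
Proof.
rewrite -(@lpi0 R dsum_lsetoid); split=> [/lpiP/(_ j)|Ia].
  by rewrite /word_coord big_cons !big_nil eqxx addr0 subr0.
apply/lpiP => k; rewrite /word_coord big_cons !big_nil subr0 /=.
by case: eqP => [<-|_]; rewrite ?addr0 //; have [] := I_ideal k.
Qed.

Lemma dsum_in_eq j a b : dsum_in j a = dsum_in j b <-> I j (a - b).
Proof.
rewrite -dsum_in_eq0 dsum_inD -mulN1r dsum_inZ scaleN1r.
by split=> [->|/eqP]; rewrite ?subrr // subr_eq0 => /eqP.
Qed.

Lemma dsum_ind (P : dsum -> Prop) : P 0 -> (forall x y, P x -> P y -> P (x + y)) ->
  (forall j a, P (dsum_in j a)) -> forall x, P x.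
Proof.
move=> P0 PD Pin x; have [u ->] := lpi_surj x.
elim: u => [//|[j a] u IH].
by rewrite (@lpiD R dsum_lsetoid [:: (j, a)] u); apply: PD; [exact: Pin | exact: IH].
Qed.

Lemma dsum_ideal_mul_coord j (x : dsum) (p : R -> Prop) : is_ideal p ->
  (forall a, I j a -> p a) -> ideal_mul p x -> p (dsum_coord j x).
Proof.
move=> pI Ip [n [a [y [pa ->]]]]; have [p0 pD pM] := pI.
elim/big_ind: _ => [|x1 x2 px1 px2|i _]; first exact/Ip/dsum_coord0.
  by apply: (ideal_ladd pI (Ip _ (dsum_coordD j x1 x2))); apply: pD.
by apply: (ideal_ladd pI (Ip _ (dsum_coordZ j _ _))); apply: (is_idealMr pI).
Qed.

End DirectSum.

Lemma dsum_fg (R : comPzRingType) (n : nat) (I : 'I_n -> R -> Prop)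
  (I_ideal : forall j, is_ideal (I j)) : finitely_generated (dsum I_ideal).
Proof.
exists n, (fun i => dsum_in I_ideal i 1); elim/dsum_ind => [|x y [a ->] [b ->]|j c].
- by exists (fun=> 0); rewrite big1 // => i _; rewrite scale0r.
- exists (fun i => a i + b i); rewrite -big_split; apply: eq_bigr => i _.
  by rewrite scalerDl.
- exists (fun i => if i == j then c else 0); rewrite (bigD1 j) //= eqxx.
  rewrite -dsum_inZ mulr1 big1 ?addr0 // => i /negPf ->.
  by rewrite scale0r.
Qed.

(** * Supports, and the vanishing of tensor products *)

Section Support.
Variable R : comPzRingType.
Implicit Types (M N : lmodType R) (m p : R -> Prop).

(** The prime p is in the support of M: some x/1 is nonzero in M_p.  Quantifying over
    elements of M keeps the fractions away. *)
Definition supp M p := exists x : M, forall s, ~ p s -> s *: x <> 0.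

Lemma not_supp M p : ~ supp M p -> forall x : M, exists2 s, ~ p s & s *: x = 0.
Proof.
move=> nsupp x; apply: contrapT => H; apply: nsupp; exists x => s ps sx.
by apply: H; exists s.
Qed.

Lemma supp_sub M N p (f : {linear M -> N}) : injective f -> supp M p -> supp N p.
Proof.
move=> finj [x xP]; exists (f x) => s /xP sx fsx; apply: sx.
by apply: finj; rewrite linearZ /= fsx linear0.
Qed.

(** The annihilator of x is a proper ideal, hence lies in some maximal m. *)
Lemma maximal_above_ann M (x : M) : x <> 0 ->
  exists2 m, is_maximal_ideal m & forall s, ~ m s -> s *: x <> 0.
Proof.
move=> x0; have [||m mm annm] := @maximal_above R (fun a => a *: x = 0).
- split=> [|a b ax bx|a b bx]; first exact: scale0r.
    by rewrite scalerDl ax bx addr0.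
  by rewrite -scalerA bx scaler0.
- by rewrite scale1r.
by exists m => // s ms /annm.
Qed.

Lemma ideal_mul0 p N : ideal_mul p (0 : N).
Proof.
by exists 0%N, (fun=> 0), (fun=> 0); split; [case | rewrite big_ord0].
Qed.

Lemma ideal_mulD p N (x y : N) : ideal_mul p x -> ideal_mul p y -> ideal_mul p (x + y).
Proof.
move=> [n [a [x' [pa ->]]]] [k [b [y' [pb ->]]]].
exists (n + k)%N, (fun i => match split i with inl i => a i | inr i => b i end),
  (fun i => match split i with inl i => x' i | inr i => y' i end); split.
  by move=> i; case: split.
rewrite big_split_ord; congr (_ + _); apply: eq_bigr => i _.
  by rewrite (unsplitK (inl i)).
by rewrite (unsplitK (inr i)).
Qed.

Lemma ideal_mul_gen p N a (x : N) : p a -> ideal_mul p (a *: x).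
Proof. by exists 1%N, (fun=> a), (fun=> x); rewrite big_ord1. Qed.

Lemma ideal_mul_lin p M N (f : M -> N) :
  {morph f : x y / x + y} -> (forall a, {morph f : x / a *: x}) ->
  forall x, ideal_mul p x -> ideal_mul p (f x).
Proof.
move=> fD fZ _ [n [a [y [pa ->]]]].
have f0 : f 0 = 0 by rewrite -(scale0r 0) fZ scale0r.
rewrite (big_morph f fD f0); exists n, a, (fun i => f (y i)); split=> //.
by apply: eq_bigr => i _; rewrite fZ.
Qed.

Lemma ideal_mulZ p N a (x : N) : ideal_mul p x -> ideal_mul p (a *: x).
Proof.
apply: (@ideal_mul_lin _ _ _ (fun x => a *: x)) => [y z|b y]; first exact: scalerDr.
by rewrite !scalerA mulrC.
Qed.

Lemma ideal_mul_submodule p N : is_submodule (@ideal_mul R p N).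
Proof.
by split; [exact: ideal_mul0 | exact: ideal_mulD | exact: ideal_mulZ].
Qed.

(** A nonzero linear form on the R/m-vector space M/mM, not vanishing at x, given
    through representatives in R.  A submodule K containing mM and maximal among
    those avoiding x is a hyperplane complementary to the line of x, and f y is
    the coordinate of y along x. *)
Lemma maximal_functional M m (x : M) : is_maximal_ideal m -> ~ ideal_mul m x ->
  exists f : M -> R, [/\ forall y z, m (f (y + z) - (f y + f z)),
    forall a y, m (f (a *: y) - a * f y) & ~ m (f x)].
Proof.
move=> mm mx; have [mI m1 _] := mm; have [m0 mD mM] := mI.
have [K [[K0 KD KZ] mK Kx Kmax]] := maximal_avoiding (ideal_mul_submodule m M) mx.
have Km a : K (a *: x) -> m a.
  move=> Ka; apply: contrapT => /(maximal_inv mm)[b mb]; apply: Kx.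
  have -> : x = b *: (a *: x) + (1 - b * a) *: x.
    by rewrite scalerA -scalerDl addrCA subrr addr0 scale1r.
  by apply: KD; [apply: KZ | apply/mK/ideal_mul_gen].
have [f fK] : {f : M -> R & forall y, K (y - f y *: x)}.
  apply: (@choice _ _ (fun y a => K (y - a *: x))) => y.
  have [Ky|/Kmax[a Ka]] := pselect (K y); first by exists 0; rewrite scale0r subr0.
  have /(maximal_inv mm)[b mb] : ~ m a.
    move=> ma; apply: Kx; rewrite -[x](subrK (a *: y)).
    by apply: KD => //; apply/mK/ideal_mul_gen.
  exists b; have -> : y - b *: x = (1 - b * a) *: y + - b *: (x - a *: y).
    by rewrite scalerBl scale1r scaleNr scalerBr scalerA opprB subrKA.
  by apply: KD; [apply/mK/ideal_mul_gen | apply: KZ].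
have KB y z : K y -> K z -> K (y - z).
  by move=> Ky Kz; rewrite -scaleN1r; apply/KD/KZ.
exists f; split.
- move=> y z; apply: Km.
  have -> : (f (y + z) - (f y + f z)) *: x =
      (y - f y *: x) + (z - f z *: x) - (y + z - f (y + z) *: x).
    by rewrite addrACA -opprD -scalerDl opprB [RHS]addrC subrKA scalerBl.
  by apply: KB => //; apply: KD.
- move=> a y; apply: Km.
  have -> : (f (a *: y) - a * f y) *: x =
      a *: (y - f y *: x) - (a *: y - f (a *: y) *: x).
    by rewrite scalerBr scalerA opprB [RHS]addrC subrKA scalerBl.
  by apply: KB => //; apply: KZ.
- move=> mfx; apply: Kx; rewrite -[x](subrK (f x *: x)).
  by apply: KD => //; apply/mK/ideal_mul_gen.
Qed.

(** The product of two forms modulo m is a bilinear map to R/m, nonzero at (x, y). *)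
Lemma tensor_neq0 M N m (x : M) (y : N) : is_maximal_ideal m ->
  ~ ideal_mul m x -> ~ ideal_mul m y -> tens x y <> 0.
Proof.
move=> mm /(maximal_functional mm)[f [fD fZ fx]] /(maximal_functional mm)[g [gD gZ gy]].
have [mI m1 _] := mm; have [_ _ mP] := maximal_prime mm.
have mI1 (i : 'I_1) := mI.
pose q := dsum_in mI1 ord0.
have qE a b : q a = q b <-> m (a - b) by apply: dsum_in_eq.
have [||||h hE] := @tensor_universal R M N _ (fun u v => q (f u * g v)).
- move=> u u' v; rewrite -dsum_inD; apply/qE; rewrite -mulrDl -mulrBl.
  exact: (is_idealMr mI).
- move=> u v v'; rewrite -dsum_inD; apply/qE; rewrite -mulrDr -mulrBr.
  by have [_ _ mM] := mI; apply: mM.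
- move=> a u v; rewrite -dsum_inZ; apply/qE; rewrite mulrA -mulrBl.
  exact: (is_idealMr mI).
- move=> a u v; rewrite -dsum_inZ; apply/qE; rewrite mulrCA -mulrBr.
  by have [_ _ mM] := mI; apply: mM.
move=> txy; have /dsum_in_eq0 : q (f x * g y) = 0 by rewrite -hE txy linear0.
by case/mP.
Qed.

(** The condition M_p <> 0 -> M_p <> p M_p, with denominators cleared: x/1 lies in
    p M_p exactly when s x lies in p M for some s outside of p. *)
Definition nakayama_at M p := supp M p ->
  exists x : M, forall s, ~ p s -> ~ ideal_mul p (s *: x).

Lemma locally_nakayamaP M :
  locally_nakayama M <-> forall p, is_prime_ideal p -> nakayama_at M p.
Proof.
have supp_loc (p : Spec R) : supp M p <-> exists x : localization M p, x <> 0.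
  split=> [[x xP]|[z]].
    exists (frac x (denom1 p)) => /lpiP[s] /=.
    by rewrite scale1r !scaler0; apply/xP/denomP.
  have [[x t] ->] := lpi_surj z => z0; exists x => s ps sx; apply: z0.
  have psb : `[< ~ p s >] by apply/asboolP.
  by apply/lpiP; exists (Sub s psb); rewrite /= scale1r !scaler0.
have mul_loc (p : Spec R) : (forall z : localization M p, ideal_mul p z) <->
    (forall x : M, exists2 s, ~ p s & ideal_mul p (s *: x)).
  have [pI p1 pM] := specP p; split=> [H x|H z].
    suff: exists2 xs : M * denom p, ideal_mul p xs.1 &
        frac x (denom1 p) = @lpi R (loc_lsetoid M p) xs.
      move=> [[y t] /= py /lpiP[s /= sxy]].
      exists (sval s * sval t); first by move=> /pM[]; apply: denomP.
      by rewrite -scalerA sxy scalerA; apply: ideal_mulZ.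
    have [n [a [y [pa ->]]]] := H (frac x (denom1 p)).
    elim/big_ind: _ => [|_ _ [z1 pz1 ->] [z2 pz2 ->]|i _].
    - by exists (0, denom1 p); [exact: ideal_mul0 |].
    - exists (loc_add z1 z2); last by rewrite -lpiD.
      by apply: ideal_mulD; apply: ideal_mulZ.
    - have [z ->] := lpi_surj (y i); exists (loc_scale (a i) z); last by rewrite -lpiZ.
      exact: ideal_mul_gen.
  have [[x t] ->] := lpi_surj z; have [s ps psx] := H x.
  have psb : `[< ~ p s >] by apply/asboolP.
  (* Dividing by the fixed denominator st is linear, and x/t = (s x)/(s t). *)
  pose f (y : M) := frac y (denomM (Sub s psb) t).
  have -> : @lpi R (loc_lsetoid M p) (x, t) = f (s *: x).
    apply/lpiP; exists (denom1 p) => /=.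
    by rewrite !scalerA; congr (_ *: _); ring.
  apply: (@ideal_mul_lin _ _ _ f) psx => [y1 y2|a y]; last by rewrite /f /frac -lpiZ.
  rewrite /f /frac -lpiD; apply/lpiP; exists (denom1 p) => /=.
  by rewrite !scale1r !scalerDr !scalerA.
split=> [nakM p pp /(supp_loc (SpecPoint pp))/nakM H|H p /supp_loc/(H _ (specP p))[x xP]].
  apply: contrapT => noex; apply/H/mul_loc => x; apply: contrapT => nx; apply: noex.
  by exists x => s ps psx; apply: nx; exists s.
by move=> /mul_loc/(_ x)[s /xP].
Qed.

Lemma tens0l M N (y : N) : tens (0 : M) y = 0.
Proof. by rewrite -(scale0r 0) tensZl scale0r. Qed.

Lemma tens0r M N (x : M) : tens x (0 : N) = 0.
Proof. by rewrite -(scale0r 0) tensZr scale0r. Qed.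

(** Maximal ideals suffice on both sides: a nonzero element of the tensor product
    survives at some maximal ideal, while at a common maximal m of the supports
    the fibres M/mM and N/mN are nonzero vector spaces over R/m. *)
Lemma tensor_eq0P M N : locally_nakayama M -> locally_nakayama N ->
  (forall t : tensor M N, t = 0) <->
  (forall m, is_maximal_ideal m -> ~ (supp M m /\ supp N m)).
Proof.
move=> /locally_nakayamaP nakM /locally_nakayamaP nakN; split.
  move=> t0 m mm [/(nakM m (maximal_prime mm))[x xP] /(nakN m (maximal_prime mm))[y yP]].
  have m1 : ~ m 1 by case: mm.
  apply: (tensor_neq0 (x := x) (y := y) mm _ _ (t0 _)).
    by have := xP 1 m1; rewrite scale1r.
  by have := yP 1 m1; rewrite scale1r.
move=> disj t; have [u ->] := lpi_surj t; rewrite lpi_tens big1 // => -[x y] _ /=.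
apply: contrapT => /maximal_above_ann[m mm xyP]; apply: (disj m mm).
split; apply: contrapT => /not_supp H.
  by have [s /xyP] := H x; rewrite -tensZl => sxy sx; apply: sxy; rewrite sx tens0l.
by have [s /xyP] := H y; rewrite -tensZr => sxy sy; apply: sxy; rewrite sy tens0r.
Qed.

End Support.

(** * Finitely generated modules *)

Section FinitelyGenerated.
Variable R : comPzRingType.
Implicit Types (M N : lmodType R) (p : R -> Prop).

Lemma prime_prod p (I : Type) (r : seq I) (s : I -> R) : is_prime_ideal p ->
  (forall i, ~ p (s i)) -> ~ p (\prod_(i <- r) s i).
Proof.
by move=> [_ p1 pM] ps; elim/big_ind: _ => // a b pa pb /pM[].
Qed.

Lemma prod_scale_closed M n (e : 'I_n -> M) (s : 'I_n -> R) (P : M -> Prop) i :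
  (forall a x, P x -> P (a *: x)) -> P (s i *: e i) ->
  P ((\prod_j s j) *: e i).
Proof. by move=> PZ Ps; rewrite (bigD1 i) //= mulrC -scalerA; apply: PZ. Qed.

(** The determinant is a polynomial in the entries, so it preserves congruences. *)
Lemma det_ideal p n (A B : 'M[R]_n) : is_ideal p ->
  (forall i j, p (A i j - B i j)) -> p (\det A - \det B).
Proof.
move=> pI pAB; have [p0 _ pM] := pI.
apply: (big_ind2 (fun x y => p (x - y))) => [|a b c d|s _]; first by rewrite subrr.
  exact: ideal_eqD.
rewrite -mulrBr; apply: pM.
apply: (big_ind2 (fun x y => p (x - y))) => [|a b c d|i _]; first by rewrite subrr.
  exact: ideal_eqM.
exact: pAB.
Qed.

Lemma ideal_mul_fg p M n (e : 'I_n -> M) : is_ideal p ->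
  (forall x, exists a : 'I_n -> R, x = \sum_i a i *: e i) ->
  forall x, ideal_mul p x ->
  exists2 a : 'I_n -> R, forall i, p (a i) & x = \sum_i a i *: e i.
Proof.
move=> [p0 pD pM] egen _ [k [b [y [pb ->]]]]; elim/big_ind: _.
- by exists (fun=> 0) => //; rewrite big1 // => i _; rewrite scale0r.
- move=> _ _ [a pa ->] [c pc ->]; exists (fun i => a i + c i) => [i|]; first exact: pD.
  by rewrite -big_split; apply: eq_bigr => i _; rewrite scalerDl.
- move=> i _; have [c ->] := egen (y i); exists (fun j => c j * b i) => [j|].
    exact: pM.
  by rewrite scaler_sumr; apply: eq_bigr => j _; rewrite scalerA mulrC.
Qed.

(** Nakayama's lemma by the determinant trick.  If M_p = p M_p, a common denominator
    S outside of p gives S e_i = sum_j A_ij e_j with A over p; the determinant of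
    S - A kills M, but it is congruent to a power of S modulo p. *)
Lemma fg_nakayama_at M p : finitely_generated M -> is_prime_ideal p -> nakayama_at M p.
Proof.
move=> [n [e egen]] pp [x xP]; have [pI p1 pM] := pp.
apply: contrapT => H.
have {H} [s sP] : {s : 'I_n -> R & forall i, ~ p (s i) /\ ideal_mul p (s i *: e i)}.
  apply: (@choice _ _ (fun i s => ~ p s /\ ideal_mul p (s *: e i))) => i.
  apply: contrapT => H'; apply: H; exists (e i) => s ps psi; apply: H'.
  by exists s.
pose S := \prod_j s j.
have pS : ~ p S by apply: prime_prod => // i; case: (sP i).
have [A AP] : {A : 'I_n -> 'I_n -> R &
    forall i, (forall j, p (A i j)) /\ S *: e i = \sum_j A i j *: e j}.
  apply: (@choice _ _ (fun i a => (forall j, p (a j)) /\ S *: e i = \sum_j a j *: e j)) => i.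
  have [a pa Ea] : exists2 a : 'I_n -> R, forall j, p (a j) & S *: e i = \sum_j a j *: e j.
    apply: (ideal_mul_fg pI egen); apply: prod_scale_closed => [b y|].
      exact: ideal_mulZ.
    by case: (sP i).
  by exists a.
pose B := S%:M - \matrix_(i, j) A i j.
have B0 i : \sum_j B i j *: e j = 0.
  have -> : \sum_j B i j *: e j = \sum_j (S%:M : 'M_n) i j *: e j - \sum_j A i j *: e j.
    by rewrite -sumrB; apply: eq_bigr => j _; rewrite !mxE scalerBl.
  rewrite -(proj2 (AP i)) (bigD1 i) //= mxE eqxx big1 ?addr0 ?subrr // => j /negPf ji.
  by rewrite mxE eq_sym ji scale0r.
have detB0 k : \det B *: e k = 0.
  have -> : \det B *: e k = \sum_j ((\det B)%:M : 'M_n) k j *: e j.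
    rewrite (bigD1 k) //= mxE eqxx big1 ?addr0 // => j /negPf jk.
    by rewrite mxE eq_sym jk scale0r.
  rewrite -mul_adj_mx.
  under eq_bigr do rewrite mxE scaler_suml.
  rewrite exchange_big /= big1 // => i _.
  under eq_bigr do rewrite -scalerA.
  by rewrite -scaler_sumr B0 scaler0.
have : p (\det (S%:M : 'M_n) - \det B).
  apply: det_ideal => // i j; rewrite !mxE opprB addrCA subrr addr0.
  by case: (AP i).
rewrite det_scalar => pSB; apply: (xP (\det B)).
  by move=> pB; apply: (is_prime_ideal_exp pp pS (ideal_ladd pI pSB pB)).
have [a ->] := egen x; rewrite scaler_sumr big1 // => i _.
by rewrite scalerA mulrC -scalerA detB0 scaler0.
Qed.

Lemma fg_locally_nakayama M : finitely_generated M -> locally_nakayama M.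
Proof. by move=> fgM; apply/locally_nakayamaP => p; apply: fg_nakayama_at. Qed.

(** Over a finite generating set, the elements killing each generator multiply to
    one that kills M: the support of M is the set of primes above its annihilator. *)
Lemma not_supp_fg M p : finitely_generated M -> is_prime_ideal p -> ~ supp M p ->
  exists2 s, ~ p s & forall x : M, s *: x = 0.
Proof.
move=> [n [e egen]] pp nsupp.
have [s sP] : {s : 'I_n -> R & forall i, ~ p (s i) /\ s i *: e i = 0}.
  apply: (@choice _ _ (fun i s => ~ p s /\ s *: e i = 0)) => i.
  by have [s ps se] := not_supp nsupp (e i); exists s.
exists (\prod_j s j); first by apply: prime_prod => // i; case: (sP i).
move=> x; have [a ->] := egen x; rewrite scaler_sumr big1 // => i _.
rewrite scalerA mulrC -scalerA.
rewrite (@prod_scale_closed _ _ _ _ (fun x => x = 0)) ?scaler0 //.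
  by move=> b _ ->; rewrite scaler0.
by case: (sP i).
Qed.

End FinitelyGenerated.

(** * Supports of direct sums of cyclic modules *)

Section DirectSumSupport.
Variables (R : comPzRingType) (J : choiceType) (I : J -> R -> Prop).
Hypothesis I_ideal : forall j, is_ideal (I j).

Lemma supp_dsum p : is_prime_ideal p ->
  supp (dsum I_ideal) p <-> exists j, forall a, I j a -> p a.
Proof.
move=> [pI p1 pM]; split=> [[x xP]|[j Ip]]; last first.
  exists (dsum_in I_ideal j 1) => s ps; rewrite -dsum_inZ mulr1.
  by move=> /dsum_in_eq0/Ip.
apply: contrapT => H.
suff [s /xP] : exists2 s, ~ p s & s *: x = 0 by [].
elim/dsum_ind: x {xP} => [|x y [s ps sx] [t pt ty]|j a].
- by exists 1; rewrite ?scaler0.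
- exists (s * t); first by move=> /pM[].
  by rewrite scalerDr -[in X in _ + X]scalerA ty mulrC -scalerA sx !scaler0 addr0.
- have [s Is ps] : exists2 s, I j s & ~ p s.
    apply: contrapT => H'; apply: H; exists j => s Is; apply: contrapT => ps.
    by apply: H'; exists s.
  by exists s => //; rewrite -dsum_inZ; apply/dsum_in_eq0; apply: (is_idealMr (I_ideal j)).
Qed.

(** A prime p in the support contains some I j, hence equals it, and then the
    coordinate at j maps the sum onto the field R/p, where p acts by zero. *)
Lemma dsum_locally_nakayama : (forall j, is_maximal_ideal (I j)) ->
  locally_nakayama (dsum I_ideal).
Proof.
move=> Imax; apply/locally_nakayamaP => p pp /(supp_dsum pp)[j Ip].
exists (dsum_in I_ideal j 1) => s ps; rewrite -dsum_inZ mulr1.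
have [pI _ _] := pp.
move=> /(dsum_ideal_mul_coord pI Ip) p1; apply: ps.
have p2 := Ip _ (dsum_coord_in I_ideal j s).
by have := is_idealB pI p1 p2; rewrite subKr.
Qed.

End DirectSumSupport.

Section Cyclic.
Variable R : comPzRingType.

(** The module (R/I)^n. *)
Definition dpower n (I : R -> Prop) (I_ideal : is_ideal I) : lmodType R :=
  @dsum R 'I_n (fun _ => I) (fun _ => I_ideal).

Lemma supp_dpower n I (I_ideal : is_ideal I) p : is_prime_ideal p ->
  supp (dpower n.+1 I_ideal) p <-> forall a, I a -> p a.
Proof. by move=> /supp_dsum H; rewrite H; split=> [[]//|Ip]; exists ord0. Qed.

(** R/m is cyclic but (R/m)^2 is not: if (c, d) generated it, then modulo m
    1 = (ac)(bd) = (ad)(bc) = 0 for some a, b. *)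
Lemma dpower_not_iso m (mI : is_ideal m) : ~ m 1 ->
  ~ lmod_iso (dpower 1 mI) (dpower 2 mI).
Proof.
move=> m1 /lmod_isoP[f [g [_ fK]]]; have [m0 mD mM] := mI.
pose e := f (dsum_in (fun=> mI) ord0 1).
have gen y : exists a, y = a *: e.
  suff [a Ea] : exists a, g y = dsum_in (fun=> mI) ord0 a.
    by exists a; rewrite -[y]fK Ea -[a]mulr1 dsum_inZ linearZ mulr1.
  elim/dsum_ind: (g y) => [|_ _ [a ->] [b ->]|j a].
  - by exists 0; apply/esym/dsum_in_eq0.
  - by exists (a + b); rewrite dsum_inD.
  - by exists a; rewrite (ord1 j).
pose c := dsum_coord (I_ideal := fun=> mI) ord0 e.
pose d := dsum_coord (I_ideal := fun=> mI) ord_max e.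
have [a Ea] := gen (dsum_in (fun=> mI) ord0 1).
have [b Eb] := gen (dsum_in (fun=> mI) ord_max 1).
have ac : m (1 - a * c).
  have H := @dsum_coordZ R 'I_2 (fun=> m) (fun=> mI) ord0 a e.
  have H' := @dsum_coord_in R 'I_2 (fun=> m) (fun=> mI) (@ord0 1) 1.
  by have := is_idealB mI H H'; rewrite -Ea opprB addrC subrKA.
have bd : m (1 - b * d).
  have H := @dsum_coordZ R 'I_2 (fun=> m) (fun=> mI) ord_max b e.
  have H' := @dsum_coord_in R 'I_2 (fun=> m) (fun=> mI) (@ord_max 1) 1.
  by have := is_idealB mI H H'; rewrite -Eb opprB addrC subrKA.
have ad : m (a * d).
  have H := @dsum_coordZ R 'I_2 (fun=> m) (fun=> mI) ord_max a e; rewrite -Ea in H.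
  have H' := @dsum_coord_in_neq R 'I_2 (fun=> m) (fun=> mI) (@ord0 1) ord_max 1 isT.
  by have := is_idealB mI H' H; rewrite subKr.
apply: m1; have -> : 1 = (1 - a * c) + (a * c * (1 - b * d) + b * c * (a * d)) by ring.
by apply: (mD) => //; apply: (mD); apply: (mM).
Qed.

End Cyclic.

(** * Supports of isomorphism classes *)

Section ClassSupport.
Variable R : comPzRingType.
Implicit Types (C D : isoclass R) (M N : lmodType R) (m : Omega R).

Definition class_supp C (m : Omega R) := supp (iso_repr C) (sval m).

Lemma iso_supp M N p : lmod_iso M N -> supp M p -> supp N p.
Proof. by move=> [f fbij]; apply: (supp_sub (bij_inj fbij)). Qed.

Lemma class_suppE M m : class_supp (iso_cls M) m <-> supp M (sval m).
Proof.
by split; apply: iso_supp; [| apply: lmod_iso_sym]; apply: iso_repr_cls.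
Qed.

Lemma iso_cls_eq0 M : iso_cls M = @zero_class R <-> forall x : M, x = 0.
Proof.
rewrite iso_clsP; split=> [[f fbij] x|M0].
  by apply: (bij_inj fbij); rewrite linear0; apply: thinmx0.
exists \0; exists (fun=> 0) => x; first exact/esym/M0.
exact/esym/thinmx0.
Qed.

Lemma class_supp_nonempty C : C <> @zero_class R <-> exists m, class_supp C m.
Proof.
rewrite -(iso_reprK C) iso_cls_eq0; split=> [nz|[m /class_suppE[x xP]] z].
  have [x x0] : exists x : iso_repr C, x <> 0.
    by apply: contrapT => H; apply: nz => x; apply: contrapT => x0; apply: H; exists x.
  have [m mm xm] := maximal_above_ann x0.
  by exists (exist _ m mm); apply/class_suppE; exists x.
have [_ m1 _] := svalP m.
by apply: (xP 1 m1); apply: z.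
Qed.

Lemma tensor_class_eq0 C D : nak_class C -> nak_class D ->
  tensor_class C D = @zero_class R <-> forall m, ~ (class_supp C m /\ class_supp D m).
Proof.
move=> [M -> nakM] [N -> nakN]; rewrite tensor_classE iso_cls_eq0 tensor_eq0P //.
split=> [H m [/class_suppE Mm /class_suppE Nm]|H m mm [Mm Nm]].
  exact: (H _ (svalP m)).
by apply: (H (exist _ m mm)); split; apply/class_suppE.
Qed.

Lemma Omega_ext (m n : Omega R) : sval m = sval n -> m = n.
Proof.
case: m n => [m mm] [n nm] /= mn; subst n.
by congr exist; apply: Prop_irrelevance.
Qed.

Lemma Omega_ideal (m : Omega R) : is_ideal (sval m).
Proof. by case: (svalP m). Qed.

Lemma Omega_incl m n : (forall a, sval m a -> sval n a) -> m = n.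
Proof.
by move=> mn; apply/Omega_ext/maximal_incl/mn; [apply: svalP | apply/maximal_prime/svalP].
Qed.

(** The class of (R/m)^k. *)
Definition residue_power k m : isoclass R := iso_cls (dpower k (Omega_ideal m)).

Lemma supp_residue_power k m n : class_supp (residue_power k.+1 m) n <-> n = m.
Proof.
rewrite class_suppE supp_dpower; last exact/maximal_prime/svalP.
by split=> [/Omega_incl|-> //].
Qed.

Lemma fg_nak C : fg_class C -> nak_class C.
Proof. by move=> [M -> fgM]; exists M => //; apply: fg_locally_nakayama. Qed.

Lemma residue_power_fg k m : fg_class (residue_power k m).
Proof. by exists (dpower k (Omega_ideal m)) => //; apply: dsum_fg. Qed.

End ClassSupport.

(** * Diameter and girth of a graph *)

Section GraphMetric.
Variable G : graph.

Lemma is_diam_Some n : (forall u v : vertex G, exists2 k, (k <= n)%N & walk k u v) ->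
  (exists u v : vertex G, walk n u v /\ forall k, walk k u v -> (n <= k)%N) ->
  is_diam G (Some n).
Proof.
move=> near [u [v [uv far]]]; split=> [d [x [y [dxy _]]]|d]; last first.
  apply; exists u, v; split=> [_ [k kuv ->]|[k|] //]; first exact: far.
    by apply; exists n.
  by move=> /(_ (Some n)); apply; exists n.
have [k kn xy] := near x y.
have /= := dxy (Some k); case: d {dxy} => [d|] dk; last by case: dk; exists k.
by apply: leq_trans kn; apply: dk; exists k.
Qed.

Lemma is_girth_Some n : has_cycle G n -> (forall k, has_cycle G k -> (n <= k)%N) ->
  is_girth G (Some n).
Proof.
move=> cyc short; split=> [_ [k kc ->]|d]; first exact: short.
by apply; exists n.
Qed.

Lemma girth_triangle (c : 'I_3 -> vertex G) :
  injective c -> (forall i j, i != j -> adj (c i) (c j)) -> is_girth G (Some 3).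
Proof.
move=> cinj cadj; apply: is_girth_Some => [|k []//].
by split=> //; exists c; split=> // i; apply: cadj; case: i => [[|[|[]]]].
Qed.

End GraphMetric.

(** * Zero-divisor graphs of classes of locally Nakayama modules *)

(** Both graphs are treated at once, for any class S between the finitely generated
    and the locally Nakayama modules. *)
Section ZeroDivisorGraph.
Variables (R : comPzRingType) (S : isoclass R -> Prop).
Hypothesis fgS : forall C, fg_class C -> S C.
Hypothesis Snak : forall C, S C -> nak_class C.

Let G := zd_graph (@tensor_class R) (@zero_class R) S.
Implicit Types (u v w : vertex G) (C : isoclass R) (m n : Omega R).

Definition vsupp v m := class_supp (sval v) m.

Lemma vertex_S v : S (sval v). Proof. by case: (svalP v). Qed.

Lemma vsupp_nonempty v : exists m, vsupp v m.
Proof. by apply/class_supp_nonempty; case: (svalP v). Qed.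

Lemma vsupp_proper v : exists m, ~ vsupp v m.
Proof.
have [Sv _ [C [SC /class_supp_nonempty[m Cm]]]] := svalP v.
move=> /(tensor_class_eq0 (Snak Sv) (Snak SC)) disj.
by exists m => vm; apply: (disj m).
Qed.

Lemma adjP u v : adj u v <-> forall m, ~ (vsupp u m /\ vsupp v m).
Proof.
rewrite -tensor_class_eq0; [|exact/Snak/vertex_S..].
split=> [[]//|uv]; split=> // E.
have [m um] := vsupp_nonempty u; move: uv; rewrite tensor_class_eq0; [|exact/Snak/vertex_S..].
by move=> /(_ m); apply; rewrite -E.
Qed.

(** If the support of C misses m, then R/m is a neighbour of C. *)
Lemma vertex_of_class C : S C -> (exists m, class_supp C m) ->
  (exists m, ~ class_supp C m) -> exists v, sval v = C.
Proof.
move=> SC /class_supp_nonempty C0 [m Cm].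
suff vC : zd_vertex (@tensor_class R) (@zero_class R) S C by exists (exist _ C vC).
have SD := fgS (residue_power_fg 1 m).
split=> //; exists (residue_power 1 m); split=> //.
  by apply/class_supp_nonempty; exists m; apply/supp_residue_power.
by apply/(tensor_class_eq0 (Snak SC) (Snak SD)) => n [Cn /supp_residue_power E]; rewrite E in Cn.
Qed.

Lemma residue_vertex k m n : m <> n -> exists v, sval v = residue_power k.+1 m.
Proof.
move=> mn; apply: vertex_of_class; first exact/fgS/residue_power_fg.
  by exists m; apply/supp_residue_power.
by exists n => /supp_residue_power/esym.
Qed.

Lemma residue_vertices : (forall m, exists n, m <> n) ->
  exists v : Omega R -> vertex G, forall m n, vsupp (v m) n <-> n = m.
Proof.
move=> ex2; have [v vE] : {v : Omega R -> vertex G & forall m, sval (v m) = residue_power 1 m}.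
  apply: (@choice _ _ (fun m v => sval v = residue_power 1 m)) => m.
  by have [n mn] := ex2 m; apply: residue_vertex mn.
by exists v => m n; rewrite /vsupp vE supp_residue_power.
Qed.

Lemma vsupp_pick : exists f : vertex G -> Omega R, forall v, vsupp v (f v).
Proof.
have [f fP] := @choice _ _ vsupp vsupp_nonempty.
by exists f.
Qed.

(** A choice of a point in each support is a proper colouring, since adjacent
    vertices have disjoint supports; any colouring separates the R/m. *)
Lemma chromatic_number : (forall m, exists n, m <> n) -> is_chromatic_number G (Omega R).
Proof.
move=> ex2; split=> [B [c cP]|B].
  have [v vP] := residue_vertices ex2; exists (c \o v) => m n /= cmn.
  apply: contrapT => mn; apply: (cP (v m) (v n)) cmn; apply/adjP => k [/vP -> /vP //].
apply; have [f fP] := vsupp_pick; exists f => u v /adjP uv fuv.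
by apply: (uv (f u)); split=> //; rewrite fuv.
Qed.

(** The supports of the vertices of a clique are disjoint and nonempty, so there are
    at most as many as points; the R/m attain this bound. *)
Lemma clique_number : (forall m, exists n, m <> n) -> is_clique_number G (Omega R).
Proof.
move=> ex2; split=> [_ [K Kc ->]|B H].
  have [f fP] := vsupp_pick; exists (f \o sval) => -[u Ku] [v Kv] /= fuv.
  apply: eq_exist; apply: contrapT => /(Kc u v Ku Kv)/adjP/(_ (f u)); apply.
  by split=> //; rewrite fuv.
have [v vP] := residue_vertices ex2.
have [|g ginj] := H {u | exists m, u = v m}.
  exists (fun u => exists m, u = v m) => // _ _ [m ->] [n ->] mn; apply/adjP => k.
  by move=> [/vP -> /vP E]; apply: mn; rewrite E.
exists (fun m => g (exist _ (v m) (ex_intro _ m erefl))) => m n /ginj[vmn].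
by apply/vP; rewrite -vmn; apply/vP.
Qed.

Lemma no_vertex_local : card_eq 'I_1 (Omega R) -> vertex G -> False.
Proof.
move=> [f [g _ gK]] v; have [m vm] := vsupp_nonempty v; have [n vn] := vsupp_proper v.
by apply: vn; rewrite -[n]gK (ord1 (g n)) -(ord1 (g m)) gK.
Qed.

Lemma walk1 u v : adj u v -> walk 1 u v.
Proof. by move=> uv; exists v. Qed.

(** The middle vertex is R/m. *)
Lemma common_missing_walk u v m : ~ vsupp u m -> ~ vsupp v m -> walk 2 u v.
Proof.
move=> um vm; have [n un] := vsupp_nonempty u.
have [w wE] : exists w, sval w = residue_power 1 m.
  by apply: (@residue_vertex 0 m n) => mn; apply: um; rewrite mn.
have wP k : vsupp w k -> k = m by rewrite /vsupp wE => /supp_residue_power.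
exists w; split; [|apply: walk1]; apply/adjP => k [].
  by move=> uk /wP E; rewrite E in uk.
by move=> /wP ->.
Qed.

(** If u misses m and v misses n, the walk is u - R/m - R/n - v, or u - R/m - v if
    m = n. *)
Lemma walk_le3 u v : exists2 k, (k <= 3)%N & walk k u v.
Proof.
have [m um] := vsupp_proper u; have [n vn] := vsupp_proper v.
have [mn|mn] := pselect (m = n).
  by exists 2 => //; apply: common_missing_walk um _; rewrite mn.
have [w wE] := @residue_vertex 0 m n mn; have [w' w'E] := @residue_vertex 0 n m (nesym mn).
have wP k : vsupp w k -> k = m by rewrite /vsupp wE => /supp_residue_power.
have w'P k : vsupp w' k -> k = n by rewrite /vsupp w'E => /supp_residue_power.
exists 3 => //; exists w; split; last (exists w'; split; last apply: walk1);
  apply/adjP => k [].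
- by move=> uk /wP E; rewrite E in uk.
- by move=> /wP -> /w'P.
- by move=> /w'P ->.
Qed.

(** The distance 2 is attained between R/m and (R/m)^2. *)
Lemma diam2 m n : m <> n ->
  (forall u v, adj u v \/ exists k, ~ vsupp u k /\ ~ vsupp v k) -> is_diam G (Some 2).
Proof.
move=> mn close; apply: is_diam_Some => [u v|].
  case: (close u v) => [uv|[k [uk vk]]]; first by exists 1 => //; apply: walk1.
  by exists 2 => //; apply: common_missing_walk uk vk.
have [u uE] := @residue_vertex 0 m n mn; have [v vE] := @residue_vertex 1 m n mn.
have uP k : vsupp u k <-> k = m by rewrite /vsupp uE supp_residue_power.
have vP k : vsupp v k <-> k = m by rewrite /vsupp vE supp_residue_power.
exists u, v; split.
  by apply: (@common_missing_walk _ _ n); rewrite (uP, vP); apply: nesym.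
case=> [|[|]] //= [].
  move/(congr1 sval); rewrite uE vE => /iso_clsP uv.
  by have [_ m1 _] := svalP m; case: (dpower_not_iso m1 uv).
by move=> w [/adjP/(_ m) uw wv]; case: uw; rewrite wv uP vP.
Qed.

(** Proper nonempty subsets of a set of two points are disjoint or equal. *)
Lemma diam2_two : card_eq 'I_2 (Omega R) -> is_diam G (Some 2).
Proof.
move=> [f [g fK gK]]; apply: (@diam2 (f ord0) (f ord_max)) => [/(can_inj fK) //|u v].
have [|nadj] := pselect (adj u v); [by left | right].
have [k [uk vk]] : exists k, vsupp u k /\ vsupp v k.
  by apply: contrapT => H; apply/nadj/adjP => k uvk; apply: H; exists k.
have unique m n : m <> k -> n <> k -> m = n.
  rewrite -(gK m) -(gK n) -(gK k).
  move: (g m) (g n) (g k) => [[|[|]] // mi] [[|[|]] // ni] [[|[|]] // ki] mk nk;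
    first [by congr f; apply: val_inj | by case: mk; congr f; apply: val_inj
      | by case: nk; congr f; apply: val_inj].
have [m um] := vsupp_proper u; have [n vn] := vsupp_proper v.
have mk : m <> k by move=> E; rewrite E in um.
have nk : n <> k by move=> E; rewrite E in vn.
by exists m; split=> //; rewrite (unique m n mk nk).
Qed.

(** The supports of C and D meet, so these are not adjacent, and a common neighbour
    would have its support outside of their union. *)
Lemma diam3 C D : S C -> S D -> (forall m, class_supp C m \/ class_supp D m) ->
  (exists m, class_supp C m /\ class_supp D m) -> (exists m, ~ class_supp C m) ->
  (exists m, ~ class_supp D m) -> is_diam G (Some 3).
Proof.
move=> SC SD cover [m [Cm Dm]] missC missD; apply: is_diam_Some; first exact: walk_le3.
have [u uE] := vertex_of_class SC (ex_intro _ m Cm) missC.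
have [v vE] := vertex_of_class SD (ex_intro _ m Dm) missD.
have far k : walk k u v -> (3 <= k)%N.
  case: k => [|[|[|]]] //=.
  - move=> uv; have [n Cn] := missC; case: (cover n) => //.
    by rewrite -vE -uv uE.
  - by move=> [w [/adjP/(_ m) uw wv]]; case: uw; rewrite wv /vsupp uE vE.
  - move=> [w [/adjP uw [w' [/adjP ww' w'v]]]]; have [n wn] := vsupp_nonempty w.
    case: (cover n) => [Cn|Dn]; first by case: (uw n); rewrite /vsupp uE.
    by case: (ww' n); rewrite w'v /vsupp vE.
have [k k3 kuv] := walk_le3 u v; exists u, v; split=> //.
by have -> : 3 = k by apply/eqP; rewrite eqn_leq k3 far.
Qed.

Lemma girth3 : card_le 'I_3 (Omega R) -> is_girth G (Some 3).
Proof.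
move=> [f finj]; have [|v vP] := residue_vertices.
  move=> m; apply: contrapT => H.
  have E n : n = m by apply: contrapT => nm; apply: H; exists n; apply: nesym.
  by have /finj := etrans (E (f ord0)) (esym (E (f ord_max))).
have vinj : injective v by move=> m n vmn; apply/vP; rewrite -vmn; apply/vP.
apply: (@girth_triangle _ (v \o f)) => [i j /vinj/finj //|i j ij].
apply/adjP => k [/vP -> /vP/finj E]; by rewrite E eqxx in ij.
Qed.

(** For maximal ideals m and n, the cycle is R/m, R/n, (R/m)^2, (R/n)^2.  A triangle
    would need three disjoint supports. *)
Lemma girth4 : card_eq 'I_2 (Omega R) -> is_girth G (Some 4).
Proof.
move=> [f [g fK gK]].
have f01 : f ord0 <> f ord_max by move/(can_inj fK).
have neq (i : 'I_2) : exists n, f i <> n.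
  by exists (f (ordS i)) => /(can_inj fK); case: i => [[|[|[]]]].
apply: is_girth_Some => [|[|[|[|[|k]]]] [] //].
  split=> //.
  have [c cE] : {c : 'I_4 -> vertex G & forall i : 'I_4,
      sval (c i) = residue_power (i./2).+1 (f (inord (odd i)))}.
    apply: (@choice _ _ (fun (i : 'I_4) v =>
      sval v = residue_power (i./2).+1 (f (inord (odd i))))) => i.
    by have [n fn] := neq (inord (odd i)); apply: residue_vertex fn.
  have cP i k : vsupp (c i) k <-> k = f (inord (odd i)).
    by rewrite /vsupp cE supp_residue_power.
  have inord_odd (i j : 'I_4) : inord (odd i) = inord (odd j) :> 'I_2 -> odd i = odd j.
    by move/(congr1 val); rewrite /= !inordK ?ltnS ?leq_b1 //; do 2 case: (odd _).
  exists c; split=> [i j cij|i].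
    have /(can_inj fK)/inord_odd oij : f (inord (odd i)) = f (inord (odd j)).
      by apply/cP; rewrite -cij; apply/cP.
    have hij : i./2 = j./2.
      have half2 (k : 'I_4) : (k./2 < 2)%N by case: k => [[|[|[|[]]]]].
      move: (congr1 sval cij) (half2 i) (half2 j); rewrite !cE oij.
      have [_ m1 _] := svalP (f (inord (odd j))).
      case: (i./2) (j./2) => [|[|//]] [|[|//]] // => [|/esym] /iso_clsP iso.
        by case: (dpower_not_iso m1 iso).
      by case: (dpower_not_iso m1 iso).
    by apply: val_inj; rewrite /= -(odd_double_half i) oij hij odd_double_half.
  apply/adjP => k [/cP -> /cP/(can_inj fK)/inord_odd].
  by case: i => [[|[|[|[]]]]].
move=> _ [c [cinj cadj]].
have [h hP] := vsupp_pick.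
have hinj : injective (g \o h \o c).
  move=> i j /= /(can_inj gK) hij; apply: contrapT => ij.
  have disj k : h (c k) <> h (c (ordS k)).
    by move=> E; have /adjP/(_ (h (c k))) := cadj k; apply; split=> //; rewrite E.
  have [E|E] : j = ordS i \/ i = ordS j.
    by move: i j ij {hij} => [[|[|[|[]]]] // ?] [[|[|[|[]]]] // ?] ij;
      [case: ij|left|right|right|case: ij|left|left|right|case: ij]; apply: val_inj.
    by apply: (disj i); rewrite -E.
  by apply: (disj j); rewrite -E.
by have := leq_card _ hinj; rewrite !card_ord.
Qed.

End ZeroDivisorGraph.

(** * Modules realizing the extremal supports *)

Section Spectrum.
Variable R : comPzRingType.
Implicit Types (k m n : Omega R) (a b : R) (C D : isoclass R).

Lemma two_maximal : ~ card_eq 'I_1 (Omega R) -> forall m, exists n, m <> n.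
Proof.
move=> not1 m; apply: contrapT => none; apply: not1.
exists (fun=> m), (fun=> ord0) => [i|n]; first by rewrite [i]ord1.
by apply: contrapT => mn; apply: none; exists n.
Qed.

Lemma not_JacP a : ~ Jac a -> exists m, ~ sval m a.
Proof.
move=> Ja; apply: contrapT => none; apply: Ja => m mm; apply: contrapT => ma.
by apply: none; exists (exist _ m mm).
Qed.

Lemma JacP a : Jac a <-> forall m, sval m a.
Proof. by split=> [Ja m|H m mm]; [exact: Ja (svalP m) | exact: (H (exist _ m mm))]. Qed.

Lemma Jac_mul a b : Jac (a * b) <-> forall m, sval m a \/ sval m b.
Proof.
rewrite JacP; split=> H m; have [mI _ mP] := maximal_prime (svalP m).
  exact: mP.
by have [_ _ mM] := mI; case: (H m) => ?; [apply: (is_idealMr mI) | apply: mM].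
Qed.

(** The direct sum of the R/n for all n other than m. *)
Lemma punctured_class m : exists2 C, nak_class C & forall n, class_supp C n <-> n <> m.
Proof.
pose J := {classic {n : Omega R | n <> m}}.
pose I (j : J) := sval (sval j).
have I_ideal j : is_ideal (I j) := Omega_ideal (sval j).
exists (iso_cls (dsum I_ideal)).
  by exists (dsum I_ideal) => //; apply: dsum_locally_nakayama => j; apply: svalP.
move=> n; rewrite class_suppE supp_dsum; last exact/maximal_prime/svalP.
split=> [[j /Omega_incl <-]|nm]; first exact: (svalP (j : {n : Omega R | n <> m})).
by exists (exist _ n nm : J).
Qed.

(** The class of R/(a). *)
Lemma principal_class a : exists2 C, fg_class C & forall m, class_supp C m <-> sval m a.
Proof.
have aI : is_ideal (fun x => exists b, x = b * a).
  split=> [|_ _ [b ->] [c ->]|c _ [b ->]]; first by exists 0; rewrite mul0r.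
    by exists (b + c); rewrite mulrDl.
  by exists (c * b); rewrite mulrA.
exists (iso_cls (dpower 1 aI)).
  by exists (dpower 1 aI) => //; apply: dsum_fg.
move=> m; rewrite class_suppE supp_dpower; last exact/maximal_prime/svalP.
have [_ _ mM] := Omega_ideal m.
by split=> [|ma _ [b ->]]; [apply; exists 1; rewrite mul1r | apply: mM].
Qed.

(** If a and b are in no common m, then b may be replaced with b t, where t separates
    two maximal ideals m and n over a: this adds m, but not n, to the zeros of b. *)
Lemma overlapping_cover_of_disjoint a b m n : m <> n -> sval m a -> sval n a ->
  Jac (a * b) -> ~ Jac a -> (forall k, ~ (sval k a /\ sval k b)) ->
  exists c d, [/\ Jac (c * d), ~ Jac c, ~ Jac d & exists k, sval k c /\ sval k d].
Proof.
move=> mn ma na Jab Ja disj.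
have nb : ~ sval n b by move=> nb; apply: (disj n).
have [t mt nt] : exists2 t, sval m t & ~ sval n t.
  apply: maximal_neq (svalP m) (svalP n) _ => E; exact/mn/Omega_ext.
exists a, (b * t); split=> //.
- move: Jab; rewrite !Jac_mul => Jab k; case: (Jab k); first by left.
  by move=> kb; right; apply: (is_idealMr (Omega_ideal k)).
- move=> /JacP/(_ n); have [_ _ nP] := maximal_prime (svalP n).
  by move=> /nP[].
- by exists m; split=> //; have [_ _ mM] := Omega_ideal m; apply: mM.
Qed.

(** Since Jac R is not prime, it contains some ab without containing a or b.  If no
    maximal ideal contains both, then two of the three given ones contain the
    same factor, and [overlapping_cover_of_disjoint] applies. *)
Lemma overlapping_cover : card_le 'I_3 (Omega R) -> ~ is_prime_ideal (@Jac R) ->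
  exists a b, [/\ Jac (a * b), ~ Jac a, ~ Jac b & exists m, sval m a /\ sval m b].
Proof.
move=> [f finj] nprime.
have [a [b [Jab Ja Jb]]] : exists a b, [/\ Jac (a * b), ~ Jac a & ~ Jac b].
  apply: contrapT => none; apply: nprime; split.
  - split=> [m [[]] //|x y Jx Jy m mm|c x Jx m mm]; have [[_ mD mM] _ _] := mm.
      by apply: mD; [apply: Jx | apply: Jy].
    by apply: mM; apply: Jx.
  - by move=> /JacP/(_ (f ord0)); have [_ m1 _] := svalP (f ord0).
  - move=> a b Jab; have [Ja|Ja] := pselect (Jac a); first by left.
    have [Jb|Jb] := pselect (Jac b); first by right.
    by case: none; exists a, b.
have [|nocommon] := pselect (exists m, sval m a /\ sval m b); first by exists a, b.
have disj k : ~ (sval k a /\ sval k b) by move=> ab; apply: nocommon; exists k.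
have disj' k : ~ (sval k b /\ sval k a) by move=> [kb ka]; apply: (disj k).
have Jba : Jac (b * a) by rewrite mulrC.
have neq i j : i != j -> f i <> f j by move=> /eqP ij /finj.
pose i1 : 'I_3 := Ordinal (isT : 1 < 3)%N.
have /Jac_mul cover := Jab.
have A m n mn ma na := @overlapping_cover_of_disjoint a b m n mn ma na Jab Ja disj.
have B m n mn mb nb := @overlapping_cover_of_disjoint b a m n mn mb nb Jba Jb disj'.
have n01 : f ord0 <> f i1 by apply: neq.
have n02 : f ord0 <> f ord_max by apply: neq.
have n12 : f i1 <> f ord_max by apply: neq.
case: (cover (f ord0)) (cover (f i1)) (cover (f ord_max)) => h0 [] h1 [] h2.
- exact: A n01 h0 h1.
- exact: A n01 h0 h1.
- exact: A n02 h0 h2.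
- exact: B n12 h1 h2.
- exact: A n12 h1 h2.
- exact: B n02 h0 h2.
- exact: B n01 h0 h1.
- exact: B n01 h0 h1.
Qed.

(** If M misses m, then some s outside of m kills M; likewise some t outside of n
    kills N.  If the supports covered Omega(R), then st would be in Jac R, whereas
    neither s nor t is. *)
Lemma fg_common_missing C D : is_prime_ideal (@Jac R) -> fg_class C -> fg_class D ->
  (exists m, ~ class_supp C m) -> (exists m, ~ class_supp D m) ->
  exists m, ~ class_supp C m /\ ~ class_supp D m.
Proof.
move=> [_ _ JP] [M -> fgM] [N -> fgN] [m Mm] [n Nn].
apply: contrapT => none.
have [s ms sM] : exists2 s, ~ sval m s & forall x : M, s *: x = 0.
  by apply: not_supp_fg => //; [apply/maximal_prime/svalP | move=> /class_suppE].
have [t nt tN] : exists2 t, ~ sval n t & forall x : N, t *: x = 0.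
  by apply: not_supp_fg => //; [apply/maximal_prime/svalP | move=> /class_suppE].
have /JP[/JacP/(_ m)|/JacP/(_ n)] // : Jac (s * t).
apply/Jac_mul => k; apply: contrapT => kst; apply: none; exists k.
split=> /class_suppE[x xP]; apply: kst; [left|right]; apply: contrapT => /xP; apply.
  exact: sM.
exact: tN.
Qed.

End Spectrum.

(** * The invariants of the two graphs *)

Theorem theorem8p3 (R : comPzRingType) :
  let G' := zd_graph (@tensor_class R) (@zero_class R) (@fg_class R) in
  let H' := zd_graph (@tensor_class R) (@zero_class R) (@nak_class R) in
  (~ card_eq 'I_1 (Omega R) ->
     [/\ is_chromatic_number G' (Omega R), is_chromatic_number H' (Omega R),
         is_clique_number G' (Omega R) & is_clique_number H' (Omega R)])
  /\ (card_eq 'I_1 (Omega R) ->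
     (vertex G' -> False) /\ (vertex H' -> False))
  /\ (card_eq 'I_2 (Omega R) ->
     [/\ is_diam G' (Some 2), is_diam H' (Some 2),
         is_girth G' (Some 4) & is_girth H' (Some 4)])
  /\ (card_le 'I_3 (Omega R) ->
     [/\ is_diam H' (Some 3), is_girth H' (Some 3) & is_girth G' (Some 3)])
  /\ (card_le 'I_3 (Omega R) -> is_prime_ideal (@Jac R) -> is_diam G' (Some 2))
  /\ (card_le 'I_3 (Omega R) -> ~ is_prime_ideal (@Jac R) ->
     is_diam G' (Some 3)).
Proof.
move=> G' H'.
have fgfg (C : isoclass R) : fg_class C -> fg_class C by [].
have naknak (C : isoclass R) : nak_class C -> nak_class C by [].
split; last split; last split; last split; last split.
- move=> /two_maximal ex2.
  by split; (apply: chromatic_number || apply: clique_number) => //; apply: fg_nak.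
- by move=> one; split; apply: no_vertex_local => //; apply: fg_nak.
- move=> two; split; try by [apply: girth4 => //; apply: fg_nak].
    exact: (diam2_two fgfg (@fg_nak R)).
  exact: (diam2_two (@fg_nak R) naknak).
- move=> three; split; try by [apply: girth3 => //; apply: fg_nak].
  have [f finj] := three.
  pose i1 : 'I_3 := Ordinal (isT : 1 < 3)%N.
  have [C nakC suppC] := punctured_class (f ord0).
  have [D nakD suppD] := punctured_class (f i1).
  apply: (diam3 (@fg_nak R) naknak nakC nakD).
  + move=> m; rewrite suppC suppD; apply: contrapT => H.
    suff /finj : f ord0 = f i1 by [].
    by transitivity m; apply: contrapT => E; apply: H; [left=> /esym | right].
  + by exists (f ord_max); rewrite suppC suppD; split=> /finj.
  + by exists (f ord0); rewrite suppC; apply.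
  + by exists (f i1); rewrite suppD; apply.
- move=> [f finj] Jprime.
  apply: (@diam2 _ _ fgfg (@fg_nak R) (f ord0) (f ord_max)) => [/finj //|u v]; right.
  apply: fg_common_missing => //; try exact: vertex_S; exact: vsupp_proper (@fg_nak R) _.
- move=> three nprime.
  have [a [b [/Jac_mul cover /not_JacP[m ma] /not_JacP[n nb] [k [ka kb]]]]] :=
    overlapping_cover three nprime.
  have [C fgC suppC] := principal_class a; have [D fgD suppD] := principal_class b.
  apply: (diam3 fgfg (@fg_nak R) fgC fgD).
  + by move=> l; rewrite suppC suppD.
  + by exists k; rewrite suppC suppD.
  + by exists m; rewrite suppC.
  + by exists n; rewrite suppD.
Qed.
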